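(* There are an absolute angle $\theta_0 > 0$ and an absolute constant $C>0$ such that for all angles $0 < \theta \leq \theta_0$, for all dimensions $n$, and any $\delta > 0$, if $m$ satisfies $$m \ge Cn \quad\text{and}\quad m \geq C\left(\frac{\pi}{2\theta}\right)^2\left(n\log(m/n) + \log(1/\delta)\right),$$ then with probability at least $1-\delta$, the measurement set $A$ comprising $m$ independent random vectors $a_1,\dots,a_m$ drawn uniformly from $S^{n-1}$ satisfies the $\mathrm{ACW}(\theta,\alpha)$ condition with $\alpha = 1/2$.
   Context: For nonzero $x,z\in\mathbb{R}^n$ with angle $\omega$ between them, the set $W_{x,z} := \{v\in S^{n-1} : \operatorname{sign}(\langle v,x\rangle)\ne\operatorname{sign}(\langle v,z\rangle)\}$ is called a (spherical) wedge of angle $\omega$. A probability measure $\mu$ on $S^{n-1}$ satisfies the $\mathrm{ACW}(\theta,\alpha)$ condition (anti-concentrated on wedges of angle $\theta$ at level $\alpha$) if for every wedge $W\subset S^{n-1}$ of angle less than $\theta$, $$\lambda_{\min}\left(\mathbb{E}\,aa^T - 4\,\mathbb{E}\,aa^T 1_W(a)\right) \ge \frac{\alpha}{n},\qquad a\sim\mu,$$ where $\lambda_{\min}$ denotes the smallest eigenvalue. A measurement set (or matrix $A$ with rows $a_1^T,\dots,a_m^T$) satisfies $\mathrm{ACW}(\theta,\alpha)$ if the measure $\mu_A=\frac1m\sum_{i=1}^m\delta_{a_i}$ does. *)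

(* Defs.v *)
From HB Require Import structures.
From mathcomp Require Import all_boot all_order all_algebra.
From mathcomp Require Import all_classical all_reals all_analysis.

Set Implicit Arguments.
Unset Strict Implicit.
Unset Printing Implicit Defensive.
Import Order.TTheory GRing.Theory Num.Theory.
Import numFieldNormedType.Exports.

Local Open Scope classical_set_scope.
Local Open Scope ring_scope.

(* MathComp-Analysis equips n.-tuple R, but not 'cV[R]_n, with a measurable
   structure. As there, take the sigma-algebra generated by the coordinates;
   on R^n it is the Borel sigma-algebra. *)
Section measurable_colvec.
Variables (R : realType) (n : nat).

Let coord : 'I_n -> 'cV[R]_n -> R := fun i v => v i ord0.

Let colvec_set0 : g_sigma_preimage coord set0.
Proof. exact: sigma_algebra0. Qed.

Let colvec_setC A : g_sigma_preimage coord A -> g_sigma_preimage coord (~` A).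
Proof. exact: sigma_algebraC. Qed.

Let colvec_bigcup (F : _^nat) : (forall i, g_sigma_preimage coord (F i)) ->
  g_sigma_preimage coord (\bigcup_i (F i)).
Proof. exact: sigma_algebra_bigcup. Qed.

HB.instance Definition _ := @isMeasurable.Build
  (measure_tuple_display default_measure_display)
  'cV[R]_n (g_sigma_preimage coord) colvec_set0 colvec_setC colvec_bigcup.

End measurable_colvec.

Section sphere.
Variables (R : realType) (n : nat).
Implicit Types (u v x z : 'cV[R]_n) (M : 'M[R]_n).

Definition dotv u v : R := (u^T *m v) ord0 ord0.

(* The library norm `|v| on matrices is the sup norm. *)
Definition enorm v : R := Num.sqrt (dotv v v).

Definition unit_sphere : set 'cV[R]_n := [set v | enorm v = 1].

Definition angle x z : R := acos (dotv x z / (enorm x * enorm z)).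

(* Num.sg takes the three values -1, 0 and 1, with Num.sg 0 = 0. *)
Definition wedge x z : set 'cV[R]_n :=
  [set v | unit_sphere v /\ Num.sg (dotv v x) <> Num.sg (dotv v z)].

Definition lambda_min M : R := inf [set l : R | eigenvalue M l].

Definition mx_expectation (mu : {measure set 'cV[R]_n -> \bar R})
    (F : 'cV[R]_n -> 'M[R]_n) : 'M[R]_n :=
  \matrix_(i, j) \int[mu]_a F a i j.

Definition ACW (theta alpha : R) (mu : {measure set 'cV[R]_n -> \bar R}) :=
  forall x z, x != 0 -> z != 0 -> angle x z < theta ->
    alpha / n%:R <=
    lambda_min (mx_expectation mu (fun a => a *m a^T)
      - 4 *: mx_expectation mu (fun a => \1_(wedge x z) a *: (a *m a^T))).

(* msum takes a nat-indexed family; k < m ranges over the list codom a of the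
   m vectors, so this is m^-1 times the sum of the Dirac masses at the a i. *)
Definition empirical_measure (m : nat) (a : 'I_m -> 'cV[R]_n) :
    {measure set 'cV[R]_n -> \bar R} :=
  mscale (m%:R^-1)%:nng
    (msum (fun k => dirac (nth 0 (codom a) k) : {measure set _ -> \bar R}) m).

(* The uniform law is the only rotation-invariant Borel probability on the
   sphere. Q ranges over all of O(n): SO(1) is trivial, so for n = 1 invariance
   under SO(n) would not determine the law. *)
Definition uniform_on_sphere (nu : probability 'cV[R]_n R) :=
  nu unit_sphere = 1%E /\
  forall Q : 'M[R]_n, Q *m Q^T = 1%:M ->
    forall B, measurable B -> nu (mulmx Q @^-1` B) = nu B.

End sphere.

Definition mutually_independent (R : realType) (d d' : measure_display)
    (T : measurableType d) (V : measurableType d') (P : probability T R)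
    (I : finType) (X : I -> {mfun T >-> V}) :=
  forall (J : {set I}) (B : I -> set V),
    (forall i, i \in J -> measurable (B i)) ->
    P (\bigcap_(i in [set` J]) (X i @^-1` B i)) =
    (\prod_(i in J) P (X i @^-1` B i))%E.

(* Main.v *)
Require Import Defs.
From HB Require Import structures.
From mathcomp Require Import all_boot all_order all_algebra fingroup perm complex.
From mathcomp Require Import all_classical all_reals all_analysis.
From mathcomp Require Import measurable_realfun.
From mathcomp Require Import ring lra zify.

Set Implicit Arguments.
Unset Strict Implicit.
Unset Printing Implicit Defensive.
Import Order.TTheory GRing.Theory Num.Theory.
Import numFieldNormedType.Exports.

Local Open Scope classical_set_scope.
Local Open Scope ring_scope.

(** The constant 1/2 leaves room, and so do theta0 and C, so that no sharp
    concentration is needed. Write s_k(u) = sqrt n <a_k, u>, which has variance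
    one for every unit vector u. Up to the factor 1 / (n m), the claim says that
    sum_k s_k(u)^2 (1 - 4 1_W(a_k)) >= m / 2 for all unit u and all wedges W of
    angle less than theta (ACW_empirical). A smaller theta weakens
    the claim and strengthens the hypothesis, so theta may be taken to be theta0, a
    small absolute constant.

    Three facts about each single direction v are used, for suitable absolute
    levels T, t and eta: sum_k s_k(v)^2 >= 7 m / 8; the squares of the excesses of
    |s_k(v)| over T add up to at most m / 512; and at most eta m of the |s_k(v)|
    are below t. By Chernoff's method (chernoff) each of them fails with
    probability at most exp (- c m), as soon as the corresponding exponential
    moment is strictly less than one (mgf_lower, mgf_excess, mgf_band). As
    m >= C (n + log (1/delta)), a union bound gives all three with probability
    1 - delta at all points of a net of the sphere with at most K^n points
    (sphere_net).

    On that event the rest is deterministic (quadratic_form_lower). The excess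
    bound on the net bounds the operator norm, sup_u sum_k s_k(u)^2 <= Lam m, and
    with it the first two facts pass from the net to every u at a small loss. If
    a_k lies in the wedge of the unit vectors x and z then
    |s_k(x)| <= |s_k(x - z)|; as sum_k s_k(x - z)^2 <= Lam m |x - z|^2 is small,
    for most such k the value |s_k(x)| is small, which by the third fact happens
    rarely. Hence a wedge contains few a_k, and few terms carry little of
    sum_k s_k(u)^2 because the part above the level T is small.

    The moments are obtained from rotation invariance alone. Sign changes of the
    coordinates show that the marginals are sub-Gaussian (sproj_subgaussian),
    uniformly in n. Anti-concentration (small_ball) holds because the event that
    one coordinate is much smaller than another has many disjoint rotated copies
    (cone_measure_le). *)

(** * Euclidean geometry of column vectors *)

Section Euclid.
Variables (R : realType) (n : nat).
Implicit Types (u v w x z : 'cV[R]_n) (Q M : 'M[R]_n).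

Lemma dotvE u v : dotv u v = \sum_i u i ord0 * v i ord0.
Proof. by rewrite /dotv mxE; apply: eq_bigr => i _; rewrite mxE. Qed.

Lemma dotvC u v : dotv u v = dotv v u.
Proof. by rewrite !dotvE; apply: eq_bigr => i _; rewrite mulrC. Qed.

Lemma dotvDl u v w : dotv (u + v) w = dotv u w + dotv v w.
Proof. by rewrite /dotv linearD mulmxDl mxE. Qed.

Lemma dotvZl c u v : dotv (c *: u) v = c * dotv u v.
Proof. by rewrite /dotv linearZ -scalemxAl mxE. Qed.

Lemma dotvDr u v w : dotv w (u + v) = dotv w u + dotv w v.
Proof. by rewrite /dotv mulmxDr mxE. Qed.

Lemma dotvZr c u v : dotv u (c *: v) = c * dotv u v.
Proof. by rewrite /dotv -scalemxAr mxE. Qed.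

Lemma dotvNr u v : dotv u (- v) = - dotv u v.
Proof. by rewrite /dotv mulmxN mxE. Qed.

Lemma dotvBr u v w : dotv w (u - v) = dotv w u - dotv w v.
Proof. by rewrite dotvDr dotvNr. Qed.

Lemma dotv0r u : dotv u 0 = 0.
Proof. by rewrite /dotv mulmx0 mxE. Qed.

Lemma dotv_mulmx Q u v : dotv (Q *m u) v = dotv u (Q^T *m v).
Proof. by rewrite /dotv trmx_mul mulmxA. Qed.

Lemma dotvv_ge0 u : 0 <= dotv u u.
Proof. by rewrite dotvE; apply: sumr_ge0 => i _; rewrite -expr2 sqr_ge0. Qed.

Lemma dotvv_eq0 u : (dotv u u == 0) = (u == 0).
Proof.
apply/idP/eqP => [|->]; last by rewrite dotv0r.
rewrite dotvE psumr_eq0 => [/allP h|i _]; last by rewrite -expr2 sqr_ge0.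
apply/matrixP => i j; rewrite (ord1 j) mxE.
by have := h i (mem_index_enum i); rewrite -expr2 sqrf_eq0 => /eqP.
Qed.

Lemma enorm_ge0 u : 0 <= enorm u. Proof. exact: sqrtr_ge0. Qed.

Lemma enorm_sq u : enorm u ^+ 2 = dotv u u.
Proof. by rewrite sqr_sqrtr // dotvv_ge0. Qed.

Lemma enorm_gt0 u : (0 < enorm u) = (u != 0).
Proof. by rewrite sqrtr_gt0 lt_neqAle dotvv_ge0 andbT eq_sym dotvv_eq0. Qed.

Lemma enormZ c u : enorm (c *: u) = `|c| * enorm u.
Proof.
rewrite /enorm dotvZl dotvZr mulrA -expr2 sqrtrM ?sqr_ge0 //.
by rewrite sqrtr_sqr.
Qed.

Lemma unit_sphereE u : unit_sphere u <-> dotv u u = 1.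
Proof.
rewrite /unit_sphere /= -enorm_sq; split => [->|/eqP]; first by rewrite expr1n.
by rewrite sqrf_eq1 => /orP[/eqP//|/eqP h]; have := enorm_ge0 u; rewrite h; lra.
Qed.

Lemma cauchy_schwarz_sq u v : dotv u v ^+ 2 <= dotv u u * dotv v v.
Proof.
have [->|v0] := eqVneq v 0; first by rewrite !dotv0r expr0n mulr0.
have vv : 0 < dotv v v by rewrite lt_neqAle dotvv_ge0 andbT eq_sym dotvv_eq0.
have := dotvv_ge0 (dotv v v *: u - dotv u v *: v).
rewrite dotvBr !dotvZr dotvDl !dotvZl -scaleNr !dotvZl.
rewrite (dotvC v u) => h.
have : 0 <= dotv v v * (dotv u u * dotv v v - dotv u v ^+ 2).
  apply: le_trans h _; rewrite dotvDl !dotvZl; lra.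
by rewrite pmulr_rge0 // subr_ge0.
Qed.

Lemma cauchy_schwarz u v : `|dotv u v| <= enorm u * enorm v.
Proof.
rewrite -(ler_pXn2r (ltn0Sn 1)) ?nnegrE ?mulr_ge0 ?enorm_ge0 //.
by rewrite real_normK ?num_real // exprMn !enorm_sq cauchy_schwarz_sq.
Qed.

Lemma normalize_unit u : u != 0 -> unit_sphere ((enorm u)^-1 *: u).
Proof.
move=> u0; rewrite /unit_sphere /= enormZ ger0_norm ?invr_ge0 ?enorm_ge0 //.
by rewrite mulVf // gt_eqF // enorm_gt0.
Qed.

(** Householder reflections: explicit orthogonal matrices that already act
    transitively on the sphere. *)
Definition reflection w : 'M[R]_n := 1%:M - (2 / dotv w w) *: (w *m w^T).

Lemma reflection_tr w : (reflection w)^T = reflection w.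
Proof.
by rewrite /reflection linearB /= trmx1 linearZ /= trmx_mul trmxK.
Qed.

Lemma reflectionE w v : reflection w *m v = v - (2 * dotv w v / dotv w w) *: w.
Proof.
rewrite /reflection mulmxBl mul1mx -scalemxAl -mulmxA.
rewrite [w^T *m v]mx11_scalar -/(dotv w v) mul_mx_scalar scalerA.
by rewrite mulrAC.
Qed.

Lemma reflection_orthogonal w : w != 0 -> reflection w *m (reflection w)^T = 1%:M.
Proof.
move=> w0; rewrite reflection_tr {2}/reflection mulmxBr mulmx1.
rewrite -scalemxAr mulmxA reflectionE.
have d0 : dotv w w != 0 by rewrite dotvv_eq0.
rewrite mulfK // (_ : w - 2 *: w = - w); last first.
  by rewrite scaler_nat mulr2n opprD addNKr.
rewrite mulNmx scalerN opprK /reflection subrK //.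
Qed.

(** Two distinct unit vectors are exchanged by the reflection along their
    difference. *)
Lemma orthogonal_transitive u v : unit_sphere u -> unit_sphere v ->
  exists2 Q : 'M[R]_n, Q *m Q^T = 1%:M & Q^T *m u = v.
Proof.
have [<- _ _|uv] := eqVneq u v.
  by exists 1%:M; rewrite trmx1 ?mulmx1 ?mul1mx.
move=> /unit_sphereE u1 /unit_sphereE v1; exists (reflection (u - v)).
  by apply: reflection_orthogonal; rewrite subr_eq0.
have ww : dotv (u - v) (u - v) = 2 - 2 * dotv u v.
  by rewrite dotvBr !(dotvC (u - v)) !dotvBr u1 v1 (dotvC v u); lra.
have w0 : 2 - 2 * dotv u v != 0 by rewrite -ww dotvv_eq0 subr_eq0.
rewrite reflection_tr reflectionE ww (dotvC (u - v)) dotvBr u1.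
rewrite (_ : 2 * _ / _ = 1); last by rewrite mulrBr mulr1 divff.
by rewrite scale1r opprB addrCA subrr addr0.
Qed.

End Euclid.

(** * Eigenvalues of real symmetric matrices *)

Section Eigen.
Variables (R : realType).

(** A complex eigenvalue of a real symmetric matrix is real: splitting an
    eigenvector into its real and imaginary parts X and Y, symmetry of the form
    X M Y^T forces Im(a) (|X|^2 + |Y|^2) = 0. *)
Lemma symmetric_eigenvalue n (M : 'M[R]_n.+1) : M^T = M ->
  exists l : R, eigenvalue M l.
Proof.
move=> Msym; set MC := map_mx (real_complex R) M.
have /closed_rootP[a] : size (char_poly MC) != 1%N by rewrite size_char_poly.
rewrite -eigenvalue_root_char => /eigenvalueP[v vM v0].
pose X := map_mx (@complex.Re R) v; pose Y := map_mx (@complex.Im R) v.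
have ReD : {morph (@complex.Re R) : x y / x + y >-> x + y} by move=> [? ?] [? ?].
have ImD : {morph (@complex.Im R) : x y / x + y >-> x + y} by move=> [? ?] [? ?].
have Re0 : complex.Re (0 : R[i]) = 0 by [].
have Im0 : complex.Im (0 : R[i]) = 0 by [].
have XM : X *m M = complex.Re a *: X - complex.Im a *: Y.
  apply/rowP => j; have /(congr1 (fun z => complex.Re z)) := congr1 (fun u : 'rV_n.+1 => u ord0 j) vM.
  rewrite !mxE [complex.Re (a * _)](_ : _ = complex.Re a * complex.Re (v ord0 j) - complex.Im a * complex.Im (v ord0 j)); last first.
    by case: (a) => ? ?; case: (v ord0 j).
  move=> <-; rewrite (big_morph _ ReD Re0).
  apply: eq_bigr => i _; rewrite !mxE.
  by case: (v ord0 i) => p q /=; rewrite mulr0 subr0.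
have YM : Y *m M = complex.Re a *: Y + complex.Im a *: X.
  apply/rowP => j; have /(congr1 (fun z => complex.Im z)) := congr1 (fun u : 'rV_n.+1 => u ord0 j) vM.
  rewrite !mxE [complex.Im (a * _)](_ : _ = complex.Re a * complex.Im (v ord0 j) + complex.Im a * complex.Re (v ord0 j)); last first.
    by case: (a) => ? ?; case: (v ord0 j).
  move=> <-; rewrite (big_morph _ ImD Im0).
  apply: eq_bigr => i _; rewrite !mxE.
  by case: (v ord0 i) => p q /=; rewrite mulr0 add0r.
have XY0 : (X != 0) || (Y != 0).
  apply: contraNT v0; rewrite negb_or !negbK => /andP[/eqP X0 /eqP Y0].
  apply/eqP/rowP => j; rewrite mxE.
  have := congr1 (fun u : 'rV_n.+1 => u ord0 j) X0.
  have := congr1 (fun u : 'rV_n.+1 => u ord0 j) Y0.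
  by rewrite !mxE; case: (v ord0 j) => p q /= -> ->.
have dX u : dotv u^T u^T = (u *m u^T) ord0 ord0 :> R by rewrite /dotv trmxK.
have YX : (X *m Y^T) ord0 ord0 = (Y *m X^T) ord0 ord0.
  by rewrite -[RHS]trace_mx11 -mxtrace_tr trmx_mul trmxK trace_mx11.
have hD (A B : 'M[R]_1) : (A + B) ord0 ord0 = A ord0 ord0 + B ord0 ord0 by rewrite mxE.
have hB (A B : 'M[R]_1) : (A - B) ord0 ord0 = A ord0 ord0 - B ord0 ord0 by rewrite !mxE.
have hZ c (A : 'M[R]_1) : (c *: A) ord0 ord0 = c * A ord0 ord0 by rewrite mxE.
have b0 : complex.Im a * (dotv X^T X^T + dotv Y^T Y^T) = 0.
  have : (X *m M *m Y^T) ord0 ord0 = (Y *m M *m X^T) ord0 ord0.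
    by rewrite -[RHS]trace_mx11 -mxtrace_tr !trmx_mul trmxK Msym mulmxA trace_mx11.
  rewrite XM YM mulmxBl mulmxDl -!scalemxAl !dX.
  rewrite hB hD !hZ YX; lra.
have a0 : complex.Im a = 0.
  move/eqP: b0; rewrite mulf_eq0 => /orP[/eqP //|].
  rewrite paddr_eq0 ?dotvv_ge0 // !dotvv_eq0 !trmx_eq0.
  by move/andP=> [/eqP X0 /eqP Y0]; move: XY0; rewrite X0 Y0 eqxx.
exists (complex.Re a); case/orP: XY0 => h; apply/eigenvalueP.
  by exists X => //; rewrite XM a0 scale0r subr0.
by exists Y => //; rewrite YM a0 scale0r addr0.
Qed.

(** Symmetry is what makes the set of eigenvalues nonempty, without which its
    infimum would be the default value 0; each eigenvalue is the value of the
    quadratic form at a unit eigenvector. *)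
Lemma lambda_min_ge n (M : 'M[R]_n) (c : R) : (0 < n)%N -> M^T = M ->
  (forall u, unit_sphere u -> c <= dotv u (M *m u)) -> c <= lambda_min M.
Proof.
case: n M => // n M _ Msym Mc; have [l Ml] := symmetric_eigenvalue Msym.
apply: lb_le_inf; first by exists l.
move=> {l Ml} l /= /eigenvalueP[v vM v0].
have w0 : v^T != 0 by rewrite trmx_eq0.
have u1 := normalize_unit w0; have := Mc _ u1.
have -> : M *m ((enorm v^T)^-1 *: v^T) = l *: ((enorm v^T)^-1 *: v^T).
  rewrite -scalemxAr -{1}Msym -trmx_mul vM linearZ /=.
  by rewrite !scalerA mulrC.
by rewrite dotvZr; move/unit_sphereE : u1 => ->; rewrite mulr1.
Qed.
End Eigen.

(** * Measurability, and expectations under the empirical measure *)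

Section Meas.
Variables (R : realType) (n : nat).

Lemma measurable_coord (i : 'I_n) :
  measurable_fun [set: 'cV[R]_n] (fun v => v i ord0).
Proof.
move=> _ Y mY; rewrite setTI; apply: sub_sigma_algebra => /=.
rewrite -bigcup_seq/=; exists i => /=; first by rewrite mem_index_enum.
by exists Y => //; rewrite setTI.
Qed.

Lemma measurable_colvec d (T : measurableType d) (f : T -> 'cV[R]_n) :
  (forall i, measurable_fun [set: T] (fun t => f t i ord0)) ->
  measurable_fun [set: T] f.
Proof.
move=> mf; suff : g_sigma_preimage (fun i (t : T) => f t i ord0) `<=` measurable.
  rewrite (@g_sigma_preimage_comp _ _ _ 'cV[R]_n (fun i v => v i ord0)) => h _ A mA.
  by apply: h; exists A.
apply: smallest_sub; first exact: sigma_algebra_measurable.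
rewrite -bigcup_seq; apply: bigcup_sub => i _ A [B mB <-].
exact: mf.
Qed.

Lemma measurable_dotv (u : 'cV[R]_n) :
  measurable_fun [set: 'cV[R]_n] (fun v => dotv v u).
Proof.
under eq_fun do rewrite dotvE.
apply: measurable_sum => i; apply: measurable_funM => //.
exact: measurable_coord.
Qed.

Lemma measurable_mulmx (Q : 'M[R]_n) : measurable_fun [set: 'cV[R]_n] (mulmx Q).
Proof.
apply: measurable_colvec => i; under eq_fun do rewrite mxE.
apply: measurable_sum => j; apply: measurable_funM => //.
exact: measurable_coord.
Qed.

Lemma measurable_sphere : measurable (@unit_sphere R n).
Proof.
have mS : measurable_fun [set: 'cV[R]_n] (fun v => \sum_i v i ord0 * v i ord0).
  by apply: measurable_sum => i; apply: measurable_funM; exact: measurable_coord.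
have -> : @unit_sphere R n = setT `&` (fun v : 'cV[R]_n => \sum_i v i ord0 * v i ord0) @^-1` [set 1].
  by rewrite setTI; apply/seteqP; split => v /=; rewrite -dotvE => /unit_sphereE.
exact: mS.
Qed.

(** The sign takes three values, so that the signs agree on the union of three
    intersections of level sets. *)
Lemma measurable_wedge x z : measurable (@wedge R n x z).
Proof.
have msg (c : R) u : measurable [set v : 'cV[R]_n | Num.sg (dotv v u) = c].
  rewrite [X in measurable X](_ : _ = setT `&` (fun v : 'cV[R]_n => dotv v u) @^-1`
      [set r | Num.sg r = c]); last by rewrite setTI.
  apply: measurable_dotv => //.
  have [c0|cn0|->] := ltgtP c 0.
  - have [->|c1] := eqVneq c (-1).
      rewrite (_ : [set _ | _] = `]-oo, 0[%classic) //.
      apply/seteqP; split => r /=; rewrite in_itv /=; first by move/eqP; rewrite sgr_cp0.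
      by move=> r0; apply/eqP; rewrite sgr_cp0.
    rewrite (_ : [set _ | _] = set0) //; apply/seteqP; split => r //=.
    by case: sgrP => _ h; move: c0 c1; rewrite -h ?eqxx ?ltxx ?ltr10.
  - have [->|c1] := eqVneq c 1.
      rewrite (_ : [set _ | _] = `]0, +oo[%classic) //.
      apply/seteqP; split => r /=; rewrite in_itv /= andbT; first by move/eqP; rewrite sgr_cp0.
      by move=> r0; apply/eqP; rewrite sgr_cp0.
    rewrite (_ : [set _ | _] = set0) //; apply/seteqP; split => r //=.
    by case: sgrP => _ h; move: cn0 c1; rewrite -h ?eqxx ?ltxx ?ltr0N1.
  - rewrite (_ : [set _ | _] = [set 0]) //.
    apply/seteqP; split => r /=; last by move=> ->; exact: sgr0.
    by move/eqP; rewrite sgr_eq0 => /eqP.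
rewrite (_ : wedge x z = @unit_sphere R n `&` ~` (\big[setU/set0]_(c <- [:: -1; 0; 1 : R])
    ([set v | Num.sg (dotv v x) = c] `&` [set v | Num.sg (dotv v z) = c]))); last first.
  apply/seteqP; split => v [Sv /= h]; split => //.
    rewrite -bigcup_seq => -[c _ [/= h1 h2]]; apply: h; by rewrite h1 h2.
  move=> e; apply: h; rewrite -bigcup_seq; exists (Num.sg (dotv v x)) => //=.
  by rewrite !inE; case: sgrP; rewrite eqxx ?orbT.
apply: measurableI; first exact: measurable_sphere.
apply: measurableC; apply: bigsetU_measurable => c _; exact: measurableI.
Qed.

(** The formulas for sums of measures and for Dirac masses concern nonnegative
    integrands; they are applied to the positive and negative parts of f. *)
Lemma Rintegral_empirical m (a : 'I_m -> 'cV[R]_n) (f : 'cV[R]_n -> R) :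
  measurable_fun setT f ->
  \int[empirical_measure a]_v f v = m%:R^-1 * \sum_(k < m) f (a k).
Proof.
move=> mf.
have ge0 (g : 'cV[R]_n -> R) : measurable_fun setT g -> (forall v, 0 <= g v) ->
    (\int[empirical_measure a]_v (g v)%:E = (m%:R^-1 * \sum_(k < m) g (a k))%:E)%E.
  move=> mg g0; rewrite /empirical_measure ge0_integral_mscale //=; first last.
  - by move=> v _; rewrite lee_fin.
  - exact/measurable_EFinP.
  rewrite ge0_integral_measure_sum //=; first last.
  - exact/measurable_EFinP.
  - by move=> v _; rewrite lee_fin.
  rewrite EFinM -sumEFin; congr (_ * _)%E; apply: eq_bigr => k _.
  rewrite integral_dirac //; last exact/measurable_EFinP.
  rewrite diracT mul1e; congr (g _)%:E.
  by rewrite (nth_map k) ?nth_ord_enum // size_enum_ord.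
rewrite /Rintegral integralE (funerpos f) (funerneg f).
rewrite (ge0 _ (measurable_funrpos mf) (funrpos_ge0 f)).
rewrite (ge0 _ (measurable_funrneg mf) (funrneg_ge0 f)) /=.
rewrite -mulrBr -sumrB; congr (_ * _); apply: eq_bigr => k _.
by rewrite -[in RHS](funrposBneg f).
Qed.

(** The quadratic form at u of the matrix in the definition of ACW is 1 / (n m)
    times the sum below. *)
Lemma ACW_empirical m (theta : R) (a : 'I_m -> 'cV[R]_n) : (0 < n)%N -> (0 < m)%N ->
  (forall x z u, x != 0 -> z != 0 -> angle x z < theta -> unit_sphere u ->
    m%:R / 2 <= \sum_(k < m) n%:R * dotv (a k) u ^+ 2 * (1 - 4 * \1_(wedge x z) (a k))) ->
  ACW theta (1 / 2) (empirical_measure a).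
Proof.
move=> n0 m0 H x z x0 z0 xz.
have mprod i j : measurable_fun [set: 'cV[R]_n] (fun v : 'cV[R]_n => (v *m v^T) i j).
  rewrite (_ : (fun v : 'cV[R]_n => _) = (fun v => v i ord0 * v j ord0)).
    by apply: measurable_funM; exact: measurable_coord.
  by apply/funext => v; rewrite mxE big_ord1 mxE.
set M := (X in lambda_min X).
have -> : M = m%:R^-1 *: \sum_(k < m) (1 - 4 * \1_(wedge x z) (a k)) *: (a k *m (a k)^T).
  apply/matrixP => i j; rewrite !mxE /= (Rintegral_empirical a (mprod i j)).
  rewrite (_ : (fun v => _) =
     (fun v : 'cV[R]_n => \1_(wedge x z) v * (v *m v^T) i j)); last first.
    by apply/funext => v; rewrite mxE.
  rewrite Rintegral_empirical; last first.
    apply: measurable_funM => //; apply: measurable_indic; exact: measurable_wedge.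
  rewrite mulrCA -mulrBr mulr_sumr -sumrB summxE; congr (_ * _).
  by apply: eq_bigr => k _; rewrite !mxE; ring.
apply: lambda_min_ge => //.
  rewrite linearZ /= raddf_sum /=; congr (_ *: _); apply: eq_bigr => k _.
  by rewrite linearZ /= trmx_mul trmxK.
move=> u u1; have := H x z u x0 z0 xz u1 => {}H.
have n0' : 0 < n%:R :> R by rewrite ltr0n.
have m0' : 0 < m%:R :> R by rewrite ltr0n.
rewrite -scalemxAl dotvZr mulmx_suml.
rewrite (_ : dotv u _ = n%:R^-1 * \sum_(k < m) n%:R * dotv (a k) u ^+ 2 * (1 - 4 * \1_(wedge x z) (a k))).
  rewrite (_ : 1 / 2 / n%:R = m%:R^-1 * (n%:R^-1 * (m%:R / 2))).
    by rewrite !ler_wpM2l ?invr_ge0 ?ler0n.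
  by field; rewrite !gt_eqF.
have lin : {morph dotv u : p q / p + q} by move=> p q; rewrite dotvDr.
rewrite mulr_sumr (big_morph _ lin (dotv0r u)); apply: eq_bigr => k _.
rewrite -scalemxAl dotvZr (_ : dotv u _ = dotv (a k) u ^+ 2).
  by rewrite -[n%:R * _ * _]mulrA mulKf ?gt_eqF // mulrC.
rewrite {1}/dotv mulmxA.
by rewrite mulmxA -mulmxA mxE big_ord1 -/(dotv u (a k)) -/(dotv (a k) u) (dotvC u) expr2.
Qed.

End Meas.

(** * Rotation-invariant laws and sub-Gaussian marginals *)

Section RealIneq.
Variable R : realType.
Implicit Types x y : R.

(** A weak form of cosh x <= exp (x^2 / 2) that follows from 1 + x <= exp x: for
    x^2 <= 1/2, bound exp (x) + exp (-x) by 1 / (1 - x) + 1 / (1 + x); for larger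
    x, use |x| <= 2 x^2. *)
Lemma cosh_le x : expR x + expR (- x) <= 2 * expR (2 * x ^+ 2).
Proof.
have [x1|x1] := leP (x ^+ 2) (1 / 2); last first.
  have h (y : R) : y ^+ 2 = x ^+ 2 -> expR y <= expR (2 * x ^+ 2).
    by move=> yx; rewrite ler_expR -yx; nra.
  by rewrite mulr2n mulrDl mul1r lerD // h // sqrrN.
have h (y : R) : y < 1 -> expR y <= (1 - y)^-1.
  move=> y1; have := expR_ge1Dx (- y); rewrite expRN => h.
  by rewrite -[expR y]invrK lef_pV2 ?posrE ?invr_gt0 ?expR_gt0 // subr_gt0.
have xl : x < 1 by nra.
have xg : - x < 1 by nra.
have -> : expR (2 * x ^+ 2) = (expR (- (2 * x ^+ 2)))^-1 by rewrite expRN invrK.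
apply: le_trans (lerD (h _ xl) (h _ xg)) _.
have d0 : 0 < 1 - x ^+ 2 by nra.
rewrite (_ : _ + _ = 2 * (1 - x ^+ 2)^-1); last first.
  by field; rewrite ?gt_eqF //; nra.
rewrite ler_pM2l // lef_pV2 ?posrE ?expR_gt0 //.
rewrite expRN -[leRHS]invrK lef_pV2 ?posrE ?expR_gt0 ?invr_gt0 //.
apply: le_trans _ (expR_ge1Dx _).
by rewrite -[leLHS]mul1r ler_pdivrMr //; nra.
Qed.
End RealIneq.

Section SphereLaw.
Variables (R : realType) (n : nat) (nu : probability 'cV[R]_n R).
Hypothesis hnu : uniform_on_sphere nu.
Implicit Types (f g : 'cV[R]_n -> R) (u v w : 'cV[R]_n).

(** The complement of the sphere is negligible. *)
Lemma sphere_le_integral f g :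
  measurable_fun setT f -> measurable_fun setT g ->
  (forall v, 0 <= f v) -> (forall v, 0 <= g v) ->
  (forall v, unit_sphere v -> f v <= g v) ->
  (\int[nu]_v (f v)%:E <= \int[nu]_v (g v)%:E)%E.
Proof.
move=> mf mg f0 g0 fg; apply: ae_ge0_le_integral => //.
- by move=> v _; rewrite lee_fin.
- exact/measurable_EFinP.
- by move=> v _; rewrite lee_fin.
- exact/measurable_EFinP.
exists (~` @unit_sphere R n); split.
- apply: measurableC; exact: measurable_sphere.
- have [nu1 _] := hnu.
  have := @probability_setC _ _ _ nu _ (@measurable_sphere R n).
  by rewrite nu1 subee.
- move=> v /= h Sv; apply: h => _; rewrite lee_fin; exact: fg.
Qed.

Lemma sphere_eq_integral f g :
  measurable_fun setT f -> measurable_fun setT g ->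
  (forall v, 0 <= f v) -> (forall v, 0 <= g v) ->
  (forall v, unit_sphere v -> f v = g v) ->
  (\int[nu]_v (f v)%:E = \int[nu]_v (g v)%:E)%E.
Proof.
move=> mf mg f0 g0 fg; apply/eqP; rewrite eq_le; apply/andP; split;
  by apply: sphere_le_integral => // v /fg ->.
Qed.

Lemma integral_const (c : R) : (\int[nu]_v c%:E = c%:E)%E.
Proof. by rewrite integral_cst // [X in (_ * X)%E](@probability_setT _ _ _ nu) mule1. Qed.

Lemma integral_orthogonal (Q : 'M[R]_n) f : Q *m Q^T = 1%:M ->
  measurable_fun setT f -> (forall v, 0 <= f v) ->
  (\int[nu]_v (f (Q *m v))%:E = \int[nu]_v (f v)%:E)%E.
Proof.
move=> QQ mf f0.
have mQ := measurable_mulmx Q.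
have := ge0_integral_pushforward mQ nu (D := setT) (f := EFin \o f) measurableT.
rewrite preimage_setT => <-; first 1 last.
- exact/measurable_EFinP.
- by move=> v _; rewrite lee_fin.
apply: eq_measure_integral => A mA _.
by have [_ ] := hnu; apply.
Qed.

(** The orthogonal group acts transitively on the sphere, so that all marginals
    have the same law. *)
Lemma integral_dotv_unit (g : R -> R) u v : unit_sphere u -> unit_sphere v ->
  measurable_fun setT g -> (forall r, 0 <= g r) ->
  (\int[nu]_a (g (dotv a u))%:E = \int[nu]_a (g (dotv a v))%:E)%E.
Proof.
move=> u1 v1 mg g0; have [Q QQ Quv] := orthogonal_transitive u1 v1.
rewrite -(integral_orthogonal QQ (f := fun a => g (dotv a u))) //.
  by under eq_integral do rewrite dotv_mulmx Quv.
by apply: measurableT_comp => //; exact: measurable_dotv.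
Qed.


(** The factor sqrt n makes the variance one under a uniform law, in every
    dimension. *)
Definition sproj v u : R := Num.sqrt n%:R * dotv v u.

Lemma measurable_sproj u : measurable_fun setT (fun v => sproj v u).
Proof. by apply: measurable_funM => //; exact: measurable_dotv. Qed.

Lemma integral_sproj_unit (g : R -> R) u v : unit_sphere u -> unit_sphere v ->
  measurable_fun setT g -> (forall r, 0 <= g r) ->
  (\int[nu]_a (g (sproj a u))%:E = \int[nu]_a (g (sproj a v))%:E)%E.
Proof.
move=> u1 v1 mg g0; apply: (integral_dotv_unit (g := g \o *%R (Num.sqrt n%:R))) => //.
  by apply: measurableT_comp => //; exact: mulrl_measurable.
by move=> r; exact: g0.
Qed.

Lemma sproj_le v u : unit_sphere v -> unit_sphere u -> sproj v u ^+ 2 <= n%:R.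
Proof.
move=> /unit_sphereE v1 /unit_sphereE u1.
rewrite /sproj exprMn sqr_sqrtr ?ler0n // -[leRHS]mulr1 ler_wpM2l ?ler0n //.
by rewrite (le_trans (cauchy_schwarz_sq _ _)) // u1 v1 mulr1.
Qed.

Let signmx (e : {ffun 'I_n -> bool}) : 'M[R]_n := diag_mx (\row_i (-1) ^+ e i).

Let signmx_orth e : signmx e *m (signmx e)^T = 1%:M.
Proof.
rewrite /signmx tr_diag_mx mulmx_diag -diag_const_mx; congr diag_mx.
by apply/rowP => i; rewrite !mxE -expr2 sqrr_sign.
Qed.

(** The law is invariant under independent sign changes of the coordinates.
    Testing along (1,...,1)/sqrt n turns the sum of the t^2 v_i^2 that arises
    from averaging over signs into the constant t^2. *)
Lemma sproj_subgaussian (t : R) u : (0 < n)%N -> unit_sphere u ->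
  (\int[nu]_v (expR (t * sproj v u))%:E <= (expR (2 * t ^+ 2))%:E)%E.
Proof.
move=> n0 u1; have sn : 0 < Num.sqrt n%:R :> R by rewrite sqrtr_gt0 ltr0n.
pose w : 'cV[R]_n := const_mx (Num.sqrt n%:R)^-1.
have w1 : unit_sphere w.
  apply/unit_sphereE; rewrite dotvE.
  under eq_bigr do rewrite !mxE -invfM -expr2 sqr_sqrtr ?ler0n //.
  by rewrite sumr_const card_ord -[LHS]mulr_natr mulVf // pnatr_eq0 -lt0n.
have mexp : measurable_fun [set: R] (fun r : R => expR (t * r)).
  by apply: measurableT_comp => //; exact: mulrl_measurable.
rewrite (integral_sproj_unit (g := fun r => expR (t * r)) u1 w1) //.
have mcoord (i : 'I_n) (c : R) : measurable_fun setT (fun v : 'cV[R]_n => expR (c * v i ord0)).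
  apply: measurableT_comp => //; apply: measurable_funM => //.
  exact: measurable_coord.
pose F (e : {ffun 'I_n -> bool}) (v : 'cV[R]_n) := \prod_i expR (t * (-1) ^+ (e i) * v i ord0).
have mF e : measurable_fun setT (F e) by apply: measurable_prod => i _; exact: mcoord.
have F0 e v : 0 <= F e v by apply: prodr_ge0 => i _; exact: expR_ge0.
have swF e : (\int[nu]_v (expR (t * sproj v w))%:E = \int[nu]_v (F e v)%:E)%E.
  rewrite -(integral_orthogonal (signmx_orth e)
     (f := fun v => expR (t * sproj v w))) //; last first.
    by apply: (measurableT_comp mexp); exact: measurable_sproj.
  apply: eq_integral => v _; congr EFin.
  rewrite /F -expR_sum; congr expR; rewrite /sproj dotvE !mulr_sumr.
  apply: eq_bigr => i _.
  by rewrite /signmx mul_diag_mx !mxE; field; rewrite gt_eqF.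
have c0 : (0 : R) < 2 ^+ n by rewrite exprn_gt0.
rewrite -(@lee_pmul2l _ (2 ^+ n)%:E) ?lte_fin // -EFinM.
have -> : (2 ^+ n)%:E = \sum_(e : {ffun 'I_n -> bool}) 1%:E :> \bar R.
  by rewrite sumEFin sumr_const card_ffun card_bool card_ord natrX.
rewrite ge0_sume_distrl //.
under eq_bigr => e _ do rewrite mul1e (swF e).
rewrite -(ge0_integral_sum nu measurableT (f := fun e v => (F e v)%:E)) //; first last.
- by move=> e v _; rewrite lee_fin.
- by move=> e; exact/measurable_EFinP.
rewrite -(integral_const).
under eq_integral do rewrite sumEFin.
apply: sphere_le_integral => //.
- by apply: measurable_sum => e; exact: mF.
- by move=> v; apply: sumr_ge0 => e _; exact: F0.
move=> v /unit_sphereE v1.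
rewrite /F -(bigA_distr_bigA (fun i (b : bool) => expR (t * (-1) ^+ b * v i ord0))) /=.
have -> : expR (2 * t ^+ 2) = \prod_i expR (2 * t ^+ 2 * (v i ord0 * v i ord0)).
  by rewrite -expR_sum -mulr_sumr -dotvE v1 mulr1.
rewrite (_ : 2 ^+ n = \prod_(i < n) 2); last by rewrite prodr_const card_ord.
rewrite -big_split /=; apply: ler_prod => i _.
rewrite big_bool /= expr0 expr1 mulr1 mulrN1 mulNr addrC addr_ge0 ?expR_ge0 //=.
apply: le_trans (cosh_le _) _; rewrite ler_pM2l // ler_expR.
by rewrite exprMn expr2 -!mulrA mulrA.
Qed.

End SphereLaw.

(** * Exponential moment of the squared marginal *)

Section ExpMoment.
Variable R : realType.
Implicit Types x y s : R.

(** The sum over j of 2 exp (1/16) exp (- j/16), to which sqexp_le_cosh leads. *)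
Definition sqexp_bound : R := 2 * expR (1 / 16) / (1 - expR (- (1 / 16))).

Let q : R := expR (- (1 / 16)).
Let q1 : q < 1. Proof. by rewrite /q expR_lt1; lra. Qed.
Let q0 : 0 < q. Proof. exact: expR_gt0. Qed.


Lemma geometric_sum_le (N : nat) : \sum_(j < N) q ^+ j <= (1 - q)^-1.
Proof.
have q1' : 0 < 1 - q by rewrite subr_gt0.
rewrite -[leRHS]mul1r ler_pdivlMr // mulrC -opprB mulNr -subrX1 opprB.
by rewrite gerDl oppr_le0 exprn_ge0 // ltW.
Qed.

(** If j is the integer part of |s|, then s^2 / 32 <= (j + 1)^2 / 32 is at most
    1/16 + j^2 / 16, while exp (j s / 4) + exp (- j s / 4) >= exp (j^2 / 4). The
    sum is finite because marginals of unit vectors are bounded, so that its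
    expectation needs no limit. *)
Lemma sqexp_le_cosh (N : nat) s : `|s| <= N%:R ->
  expR (s ^+ 2 / 32) <= \sum_(j < N.+1) expR (1 / 16 - 3 / 16 * j%:R ^+ 2) *
    (expR (j%:R / 4 * s) + expR (- (j%:R / 4) * s)).
Proof.
move=> sN; pose j := Num.truncn `|s|.
have /andP[j1 j2] : j%:R <= `|s| < j.+1%:R by apply: truncn_itv.
have jN : (j < N.+1)%N by rewrite ltnS -(ler_nat R) (le_trans j1).
rewrite (bigD1 (Ordinal jN)) //= -[leLHS]addr0 lerD //; last first.
  by apply: sumr_ge0 => i _; rewrite mulr_ge0 ?addr_ge0 ?expR_ge0.
have j0 : 0 <= j%:R :> R by [].
have h : expR (j%:R ^+ 2 / 4) <= expR (j%:R / 4 * s) + expR (- (j%:R / 4) * s).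
  have [s0|s0] := leP 0 s.
    rewrite -[leLHS]addr0 lerD ?expR_ge0 // ler_expR.
    by move: j1; rewrite ger0_norm //; nra.
  rewrite -[leLHS]add0r lerD ?expR_ge0 // ler_expR.
  by move: j1; rewrite ltr0_norm //; nra.
apply: le_trans (ler_wpM2l (expR_ge0 _) h).
rewrite -expRD ler_expR.
have : s ^+ 2 <= (j%:R + 1) ^+ 2.
  by rewrite -[s ^+ 2]real_normK ?num_real // ler_sqr ?nnegrE ?addr_ge0 // natr1 ltW.
have := sqr_ge0 (j%:R - 1 : R).
set x : R := j%:R; nra.
Qed.

Lemma sqexp_bound_ge1 : 1 <= sqexp_bound.
Proof.
rewrite /sqexp_bound ler_pdivlMr ?subr_gt0 // [leLHS]mul1r.
have := expR_ge1Dx (1 / 16 : R); have := expR_gt0 (- (1 / 16) : R); lra.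
Qed.

(** The factor is 4 * 32^2, from y^2 / 4 <= exp y at y = s^2 / 32. *)
Definition fourth_bound : R := 64 ^+ 2 * sqexp_bound.

Lemma fourth_bound_ge1 : 1 <= fourth_bound.
Proof.
rewrite /fourth_bound -[leLHS]mulr1; apply: ler_pM => //.
  by apply: exprn_ege1; rewrite ler1n.
exact: sqexp_bound_ge1.
Qed.

End ExpMoment.

Section Moments.
Variables (R : realType) (n : nat) (nu : probability 'cV[R]_n R).
Hypothesis hnu : uniform_on_sphere nu.
Hypothesis n0 : (0 < n)%N.
Implicit Types (u v w : 'cV[R]_n).

Let mS (g : R -> R) u : measurable_fun setT g ->
  measurable_fun setT (fun v => g (sproj v u)).
Proof. by move=> mg; apply: (measurableT_comp mg); exact: measurable_sproj. Qed.

Let mexpM (c : R) : measurable_fun setT (fun r : R => expR (c * r)).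
Proof. by apply: measurableT_comp => //; exact: mulrl_measurable. Qed.

Let msq (c : R) : measurable_fun setT (fun r : R => expR (r ^+ 2 / c)).
Proof.
by apply: measurableT_comp => //; apply: measurable_funM.
Qed.

Lemma sproj_sqexp u : unit_sphere u ->
  (\int[nu]_v (expR (sproj v u ^+ 2 / 32))%:E <= (sqexp_bound R)%:E)%E.
Proof.
move=> u1.
pose G (j : nat) (r : R) := expR (1 / 16 - 3 / 16 * j%:R ^+ 2) *
    (expR (j%:R / 4 * r) + expR (- (j%:R / 4) * r)).
have mG j : measurable_fun setT (G j).
  by apply: measurable_funM => //; apply: measurable_funD; exact: mexpM.
have G0 j r : 0 <= G j r by rewrite mulr_ge0 ?addr_ge0 ?expR_ge0.
apply: (@le_trans _ _ (\int[nu]_v (\sum_(j < n.+1) G j (sproj v u))%:E)%E).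
  apply: sphere_le_integral => //.
  - exact: (mS u (msq 32)).
  - by apply: measurable_sum => j; exact: mS.
  - by move=> v; apply: sumr_ge0 => j _; exact: G0.
  move=> v v1; apply: sqexp_le_cosh.
  have := sproj_le v1 u1; rewrite -[_ ^+ 2]real_normK ?num_real // => h.
  have n1 : 1 <= n%:R :> R by rewrite ler1n.
  rewrite -(ler_pXn2r (ltn0Sn 1)) ?nnegrE // (le_trans h) //.
  by rewrite -[leLHS]mulr1 expr2 ler_wpM2l.
under eq_integral do rewrite -sumEFin.
rewrite (ge0_integral_sum nu measurableT (f := fun (j : 'I_n.+1) v => (G j (sproj v u))%:E)); first last.
- by move=> j v _; rewrite lee_fin.
- by move=> j; apply/measurable_EFinP; exact: mS.
have GE (j : nat) : (\int[nu]_v (G j (sproj v u))%:E <=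
    (2 * expR (1 / 16) * expR (- (1 / 16)) ^+ j)%:E)%E.
  rewrite /G; under eq_integral do rewrite EFinM EFinD.
  rewrite ge0_integralZl_EFin ?expR_ge0 //; first last.
  - apply/measurable_EFinP; apply: (mS u (g := fun r => expR (j%:R / 4 * r) + expR (- (j%:R / 4) * r))).
    by apply: measurable_funD; exact: mexpM.
  - by move=> v _; rewrite -EFinD lee_fin addr_ge0 ?expR_ge0.
  rewrite ge0_integralD //; first last.
  - by apply/measurable_EFinP; exact: (mS u (mexpM _)).
  - by apply/measurable_EFinP; exact: (mS u (mexpM _)).
  have := leeD (sproj_subgaussian hnu (j%:R / 4) n0 u1) (sproj_subgaussian hnu (- (j%:R / 4)) n0 u1).
  rewrite -EFinD => h.
  apply: le_trans (lee_wpmul2l _ h) _; first by rewrite lee_fin expR_ge0.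
  rewrite -EFinM lee_fin sqrrN mulrDr -[leRHS]mulrA.
  have dbl (a b : R) : a <= b -> a + a <= 2 * b by lra.
  apply: dbl.
  rewrite -expRM_natl -!expRD ler_expR.
  have jj : (j%:R : R) <= j%:R ^+ 2 by rewrite -natrX ler_nat -mulnn; nia.
  by move: jj; set x : R := j%:R; lra.
apply: (@le_trans _ _ (\sum_(j < n.+1) (2 * expR (1 / 16) * expR (- (1 / 16)) ^+ j)%:E)%E).
  by apply: lee_sum => j _; exact: GE.
rewrite sumEFin lee_fin -mulr_sumr /sqexp_bound ler_wpM2l ?mulr_ge0 ?expR_ge0 //.
exact: geometric_sum_le.
Qed.

Lemma sproj_fourth u : unit_sphere u ->
  (\int[nu]_v (sproj v u ^+ 4)%:E <= (fourth_bound R)%:E)%E.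
Proof.
move=> u1; rewrite /fourth_bound EFinM.
apply: le_trans (lee_wpmul2l _ (sproj_sqexp u1)); last by rewrite lee_fin exprn_ge0.
rewrite -ge0_integralZl_EFin ?exprn_ge0 //; last first.
  by apply/measurable_EFinP; exact: (mS u (msq 32)).
under [leRHS]eq_integral do rewrite -EFinM.
apply: sphere_le_integral => //.
- by apply: (mS u (g := fun r => r ^+ 4)); exact: exprn_measurable.
- by apply: measurable_funM => //; exact: (mS u (msq 32)).
- by move=> v; rewrite (exprM _ 2 2) sqr_ge0.
move=> v _; set s := sproj v u.
have -> : expR (s ^+ 2 / 32) = expR (s ^+ 2 / 64) ^+ 2.
  by rewrite -expRM_natl; congr expR; lra.
have := expR_ge1Dx (s ^+ 2 / 64); have := sqr_ge0 s; rewrite (exprM _ 2 2).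
set y := s ^+ 2; set E := expR _; nra.
Qed.

Lemma integral_fin (f : 'cV[R]_n -> R) (c : R) : (forall v, 0 <= f v) ->
  (\int[nu]_v (f v)%:E <= c%:E)%E ->
  exists2 r : R, 0 <= r & (\int[nu]_v (f v)%:E = r%:E)%E.
Proof.
move=> f0; have : (0 <= \int[nu]_v (f v)%:E)%E.
  by apply: integral_ge0 => v _; rewrite lee_fin.
by case: (\int[nu]_v _)%E => // r; rewrite lee_fin => r0 _; exists r.
Qed.

End Moments.

(** * Second and mixed fourth moments *)

Section Second.
Variables (R : realType) (n : nat) (nu : probability 'cV[R]_n R).
Hypothesis hnu : uniform_on_sphere nu.
Hypothesis n0 : (0 < n)%N.
Implicit Types (u v w : 'cV[R]_n).

Definition basisv (i : 'I_n) : 'cV[R]_n := delta_mx i ord0.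

Lemma dotv_basisv v i : dotv v (basisv i) = v i ord0.
Proof.
rewrite dotvE (bigD1 i) //= mxE !eqxx mulr1 big1 ?addr0 // => j ji.
by rewrite mxE (negbTE ji) mulr0.
Qed.

Lemma unit_basisv i : unit_sphere (basisv i).
Proof. by apply/unit_sphereE; rewrite dotv_basisv mxE !eqxx. Qed.

Local Notation s i v := (sproj v (basisv i)).

Lemma sum_sproj_sq v : unit_sphere v -> \sum_i s i v ^+ 2 = n%:R.
Proof.
move=> /unit_sphereE v1; transitivity (n%:R * dotv v v); last by rewrite v1 mulr1.
rewrite dotvE mulr_sumr.
apply: eq_bigr => i _; rewrite /sproj dotv_basisv exprMn sqr_sqrtr ?ler0n //.
Qed.

Let mS (g : R -> R) u : measurable_fun setT g ->
  measurable_fun setT (fun v => g (sproj v u)).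
Proof. by move=> mg; apply: (measurableT_comp mg); exact: measurable_sproj. Qed.

(** The squares of the n coordinate marginals add up to n on the sphere. *)
Lemma sproj_second u : unit_sphere u ->
  (\int[nu]_v (sproj v u ^+ 2)%:E = 1%:E)%E.
Proof.
move=> u1.
have mX2 w : measurable_fun setT (fun v => sproj v w ^+ 2).
  by apply: (mS w (g := fun r => r ^+ 2)); exact: exprn_measurable.
have nR : (0 : R) < n%:R by rewrite ltr0n.
suff h : (n%:R%:E * \int[nu]_v (sproj v u ^+ 2)%:E = n%:R%:E :> \bar R)%E.
  move: h; case: (\int[nu]_v _)%E => [r||].
  - rewrite -EFinM => -[/eqP]; rewrite -[X in _ == X]mulr1 => /eqP/mulfI -> //.
    by rewrite gt_eqF.
  - by rewrite gt0_muley ?lte_fin.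
  - by rewrite gt0_muleNy ?lte_fin.
rewrite -[RHS](integral_const nu).
transitivity (\int[nu]_v (\sum_i s i v ^+ 2)%:E)%E; last first.
  apply: sphere_eq_integral => //.
  - by apply: measurable_sum => i; exact: mX2.
  - by move=> v; apply: sumr_ge0 => i _; exact: sqr_ge0.
  - by move=> v /sum_sproj_sq.
under [RHS]eq_integral do rewrite -sumEFin.
rewrite (ge0_integral_sum nu measurableT (f := fun i v => (s i v ^+ 2)%:E)); first last.
- by move=> j v _; rewrite lee_fin sqr_ge0.
- by move=> j; apply/measurable_EFinP.
rewrite (eq_bigr (fun=> \int[nu]_v (sproj v u ^+ 2)%:E)%E).
  by rewrite sumr_const card_ord mule_natl.
move=> i _; apply: (integral_sproj_unit hnu (g := fun r => r ^+ 2)) => //.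
- exact: unit_basisv.
- by move=> r; exact: sqr_ge0.
Qed.

Let mX (k : nat) w : measurable_fun setT (fun v => sproj v w ^+ k).
Proof. by apply: (mS w (g := fun r => r ^+ k)); exact: exprn_measurable. Qed.

(** From 2 s^2 <= 1 + s^4 and the second moment. *)
Lemma fourth_ge1 u : unit_sphere u ->
  (1 <= \int[nu]_v (sproj v u ^+ 4)%:E)%E.
Proof.
move=> u1; have [r r0 Er] := integral_fin (fun v => exprn_even_ge0 (sproj v u) (isT : ~~ odd 4)) (sproj_fourth hnu n0 u1).
have : (\int[nu]_v (2 * sproj v u ^+ 2)%:E <= \int[nu]_v (1 + sproj v u ^+ 4)%:E)%E.
  apply: sphere_le_integral => //.
  - exact: measurable_funM.
  - exact: measurable_funD.
  - by move=> v; rewrite mulr_ge0 ?sqr_ge0.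
  - by move=> v; rewrite addr_ge0 ?exprn_even_ge0.
  move=> v _; rewrite (exprM _ 2 2); have := sqr_ge0 (sproj v u ^+ 2 - 1).
  by set y := sproj v u ^+ 2; nra.
under eq_integral do rewrite EFinM.
under [X in (_ <= X)%E]eq_integral do rewrite EFinD.
rewrite ge0_integralZl_EFin //; first last.
- by apply/measurable_EFinP; exact: mX.
- by move=> v _; rewrite lee_fin sqr_ge0.
rewrite ge0_integralD //; first last.
- by apply/measurable_EFinP; exact: mX.
- by move=> v _; rewrite lee_fin exprn_even_ge0.
rewrite (integral_const nu 1) Er sproj_second // -EFinD -EFinM !lee_fin.
by lra.
Qed.

(** On the sphere the products s_i^2 s_l^2 add up to n s_i^2, of expectation n.
    The term l = i takes at least 1 of it, and the others have equal expectations,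
    since exchanging two coordinates preserves the law. *)
Lemma sproj_cross (i j : 'I_n) : i != j ->
  (\int[nu]_v (s i v ^+ 2 * s j v ^+ 2)%:E <= 1)%E.
Proof.
move=> ij.
pose K l := (\int[nu]_v (s i v ^+ 2 * s l v ^+ 2)%:E)%E.
have mK l : measurable_fun setT (fun v => s i v ^+ 2 * s l v ^+ 2).
  by apply: measurable_funM; exact: mX.
have K0 l v : 0 <= s i v ^+ 2 * s l v ^+ 2 by rewrite mulr_ge0 ?sqr_ge0.
have KE l : l != i -> K l = K j.
  move=> li; pose Q : 'M[R]_n := perm_mx (tperm l j).
  have QQ : Q *m Q^T = 1%:M by rewrite tr_perm_mx -perm_mxM mulgV perm_mx1.
  rewrite /K -(integral_orthogonal hnu QQ (f := fun v => s i v ^+ 2 * s j v ^+ 2)) //.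
  apply: eq_integral => v _; rewrite /sproj !dotv_basisv -row_permE !mxE.
  by rewrite tpermR tpermD // eq_sym.
have : (\sum_l K l = n%:R%:E)%E.
  rewrite -(ge0_integral_sum nu measurableT (f := fun l v => (s i v ^+ 2 * s l v ^+ 2)%:E)); first last.
  - by move=> l v _; rewrite lee_fin.
  - by move=> l; apply/measurable_EFinP.
  under eq_integral do rewrite sumEFin -mulr_sumr.
  transitivity (\int[nu]_v (n%:R * s i v ^+ 2)%:E)%E.
    apply: sphere_eq_integral => //.
    - by apply: measurable_funM => //; apply: measurable_sum => l; exact: mX.
    - by apply: measurable_funM => //; exact: mX.
    - by move=> v; rewrite mulr_ge0 ?sqr_ge0 // sumr_ge0 // => l _; exact: sqr_ge0.
    - by move=> v; rewrite mulr_ge0 ?sqr_ge0.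
    - by move=> v v1; rewrite sum_sproj_sq // mulrC.
  under eq_integral do rewrite EFinM.
  rewrite ge0_integralZl_EFin //; first last.
  - by apply/measurable_EFinP; exact: mX.
  - by move=> v _; rewrite lee_fin sqr_ge0.
  by rewrite sproj_second ?mule1 //; exact: unit_basisv.
rewrite (bigD1 i) //= (eq_bigr (fun=> K j)); last by move=> l /KE.
rewrite (_ : K i = \int[nu]_v (s i v ^+ 4)%:E)%E; last first.
  by apply: eq_integral => v _; rewrite -exprD.
have := fourth_ge1 (unit_basisv i).
case: (\int[nu]_v (s i v ^+ 4)%:E)%E => [r| |]; rewrite ?lee_fin //=; first last.
  move=> _; rewrite addye //.
  by rewrite gt_eqF // (lt_le_trans (@ltNy0 R)) // sume_ge0 // => l _; rewrite integral_ge0 // => v _; rewrite lee_fin.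
move=> r1; rewrite sumr_const.
have -> : #|[pred l | l != i]| = n.-1.
  by rewrite -[in RHS](card_ord n) -(cardC1 i); apply: eq_card => l; rewrite !inE.
have n2 : (0 < n.-1)%N.
  case: n i j ij {K mK K0 KE} => [[]//|[|//]] i j; by rewrite (ord1 i) (ord1 j).
have natmulE (x : \bar R) k : x *+ k = (k%:R%:E * x)%E by rewrite mule_natl.
rewrite -/(K j).
have : (0 <= K j)%E by apply: integral_ge0 => v _; rewrite lee_fin.
case: (K j) => [c| |] // c0.
  rewrite natmulE -EFinM -EFinD => -[e]; rewrite lee_fin.
  have np : 0 < n.-1%:R :> R by rewrite ltr0n.
  have : n%:R = n.-1%:R + 1 :> R by rewrite natr1 prednK.
  nra.
by rewrite natmulE gt0_muley ?lte_fin ?ltr0n.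
Qed.

End Second.

(** * Two exponential tests *)

Section Mgf.
Variables (R : realType) (n : nat) (nu : probability 'cV[R]_n R).
Hypothesis hnu : uniform_on_sphere nu.
Hypothesis n0 : (0 < n)%N.
Implicit Types (u v w : 'cV[R]_n) (g : R -> R).

Let mS g u : measurable_fun setT g ->
  measurable_fun setT (fun v => g (sproj v u)).
Proof. by move=> mg; apply: (measurableT_comp mg); exact: measurable_sproj. Qed.

Let mX (k : nat) w : measurable_fun setT (fun v => sproj v w ^+ k).
Proof. by apply: (mS w (g := fun r => r ^+ k)); exact: exprn_measurable. Qed.

(** Through exp (-y) <= 1 - y + y^2 for y >= 0, the lower tail of s^2 is governed by
    the second and fourth moments of s. *)
Lemma mgf_lower (l : R) u : unit_sphere u -> 0 < l -> 16 * l * fourth_bound R <= 1 ->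
  (\int[nu]_v (expR (l * (7 / 8 - sproj v u ^+ 2)))%:E <= (expR (- (l / 16)))%:E)%E.
Proof.
move=> u1 l0 lM.
have mE : measurable_fun setT (fun v => expR (- (l * sproj v u ^+ 2))).
  apply: measurableT_comp => //; apply: measurable_funN.
  exact: measurable_funM.
have H : (\int[nu]_v (expR (- (l * sproj v u ^+ 2)) + l * sproj v u ^+ 2)%:E <=
      \int[nu]_v (1 + l ^+ 2 * sproj v u ^+ 4)%:E)%E.
  apply: sphere_le_integral => //.
  - by apply: measurable_funD => //; exact: measurable_funM.
  - by apply: measurable_funD => //; exact: measurable_funM.
  - by move=> v; rewrite addr_ge0 ?expR_ge0 // mulr_ge0 ?sqr_ge0 // ltW.
  - by move=> v; rewrite addr_ge0 // mulr_ge0 ?sqr_ge0 // exprn_even_ge0.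
  move=> v _; rewrite (exprM _ 2 2) -exprMn.
  set y := l * sproj v u ^+ 2.
  have y0 : 0 <= y by rewrite mulr_ge0 ?sqr_ge0 // ltW.
  have h1 : expR (- y) <= (1 + y)^-1.
    by rewrite expRN lef_pV2 ?posrE ?expR_gt0 ?expR_ge1Dx //; lra.
  have h2 : (1 + y)^-1 <= 1 - y + y ^+ 2.
    rewrite -[leLHS]mul1r ler_pdivrMr; last by lra.
    by have := exprn_ge0 3 y0; rewrite !exprS expr0; nra.
  by lra.
move: H.
under eq_integral do rewrite EFinD EFinM.
under [X in (_ <= X)%E]eq_integral do rewrite EFinD EFinM.
rewrite ge0_integralD //; first last.
- by apply: measurable_funeM; apply/measurable_EFinP.
- by move=> v _; rewrite -EFinM lee_fin mulr_ge0 ?sqr_ge0 // ltW.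
- by apply/measurable_EFinP.
rewrite ge0_integralD //; first last.
- by apply: measurable_funeM; apply/measurable_EFinP.
- by move=> v _; rewrite -EFinM lee_fin mulr_ge0 ?sqr_ge0 // exprn_even_ge0.
rewrite ge0_integralZl_EFin ?(ltW l0) //; first last.
- by apply/measurable_EFinP; exact: mX.
- by move=> v _; rewrite lee_fin sqr_ge0.
rewrite ge0_integralZl_EFin ?sqr_ge0 //; first last.
- by apply/measurable_EFinP; exact: mX.
- by move=> v _; rewrite lee_fin exprn_even_ge0.
rewrite (integral_const nu 1) sproj_second // mule1.
have [r r0 Er] := integral_fin (fun v => exprn_even_ge0 (sproj v u) (isT : ~~ odd 4)) (sproj_fourth hnu n0 u1).
have := sproj_fourth hnu n0 u1; rewrite Er lee_fin  => rM H.
under eq_integral => v _ do rewrite mulrBr expRD EFinM.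
rewrite ge0_integralZl_EFin ?expR_ge0 //; last by apply/measurable_EFinP.
move: H; have : (0 <= \int[nu]_v (expR (- (l * sproj v u ^+ 2)))%:E)%E.
  by apply: integral_ge0 => v _; rewrite lee_fin expR_ge0.
case: (\int[nu]_v (expR _)%:E)%E => [c| |] //.
rewrite -EFinM -!EFinD !lee_fin => c0 cE.
have cl : c <= expR (- (15 / 16 * l)).
  apply: le_trans _ (expR_ge1Dx _).
  have : l ^+ 2 * r <= l * (l * fourth_bound R) by rewrite expr2 -mulrA !ler_pM2l.
  by nra.
apply: le_trans (ler_wpM2l (expR_ge0 _) cl) _.
by rewrite -expRD ler_expR; lra.
Qed.

(** Subtracting the level, instead of cutting off below it, gives a 1-Lipschitz
    function of r; this is what lets sums of squared excesses pass from the net to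
    all directions (excess_sqD_le). *)
Definition excess (t r : R) : R := Num.max (`|r| - t) 0.

Lemma excess_ge0 t r : 0 <= excess t r.
Proof. by rewrite /excess le_max lexx orbT. Qed.

Lemma measurable_excess t : measurable_fun setT (excess t).
Proof.
by apply: measurable_maxr => //; apply: measurable_funB.
Qed.

(** Beyond t one has (|s| - t)^2 <= s^2 - t^2, so that the exponential exceeds 1 by
    at most exp (- t^2 / 32) exp (s^2 / 32). *)
Lemma mgf_excess (t e : R) u : unit_sphere u -> 0 <= t ->
  sqexp_bound R * expR (- (t ^+ 2 / 32)) <= e / 64 ->
  (\int[nu]_v (expR (1 / 32 * (excess t (sproj v u) ^+ 2 - e)))%:E <=
     (expR (- (e / 64)))%:E)%E.
Proof.
move=> u1 t0 te.
set K := expR (- (t ^+ 2 / 32)).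
have K0 : 0 <= K by exact: expR_ge0.
have mE : measurable_fun setT (fun v => expR (sproj v u ^+ 2 / 32)).
  by apply: measurableT_comp => //; exact: measurable_funM.
have mex : measurable_fun setT (fun v => expR (excess t (sproj v u) ^+ 2 / 32)).
  apply: measurableT_comp => //; apply: measurable_funM => //.
  by apply: measurable_funX; apply: mS; exact: measurable_excess.
have H : (\int[nu]_v (expR (excess t (sproj v u) ^+ 2 / 32))%:E <=
      \int[nu]_v (1 + K * expR (sproj v u ^+ 2 / 32))%:E)%E.
  apply: sphere_le_integral => //.
  - by apply: measurable_funD => //; exact: measurable_funM.
  - by move=> v; rewrite addr_ge0 ?mulr_ge0 ?expR_ge0.
  move=> v _; set s := sproj v u; rewrite /excess.
  have [st|st] := leP (`|s| - t) 0.
    by rewrite expr0n mul0r expR0 lerDl mulr_ge0 ?expR_ge0.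
  apply: le_trans (_ : K * expR (s ^+ 2 / 32) <= _); last by rewrite lerDr.
  rewrite -expRD ler_expR -[s ^+ 2]real_normK ?num_real //.
  by nra.
move: H; under [X in (_ <= X)%E]eq_integral do rewrite EFinD EFinM.
rewrite ge0_integralD //; first last.
- by apply: measurable_funeM; apply/measurable_EFinP.
- by move=> v _; rewrite -EFinM lee_fin mulr_ge0 ?expR_ge0.
rewrite ge0_integralZl_EFin //; last by apply/measurable_EFinP.
rewrite (integral_const nu 1) => H.
have {H} : (\int[nu]_v (expR (excess t (sproj v u) ^+ 2 / 32))%:E <= (expR (e / 64))%:E)%E.
  apply: le_trans H _.
  apply: (@le_trans _ _ (1 + K%:E * (sqexp_bound R)%:E)%E).
    by rewrite leeD2l // lee_wpmul2l // sproj_sqexp.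
  rewrite -EFinM -EFinD lee_fin (le_trans _ (expR_ge1Dx _)) // lerD2l.
  by rewrite mulrC.
move=> H.
under eq_integral => v _.
  rewrite (_ : 1 / 32 * _ = - (e / 32) + excess t (sproj v u) ^+ 2 / 32); last by lra.
  rewrite expRD EFinM; over.
rewrite ge0_integralZl_EFin ?expR_ge0 //; last by apply/measurable_EFinP.
apply: le_trans (lee_wpmul2l _ H) _; first by rewrite lee_fin expR_ge0.
by rewrite -EFinM lee_fin -expRD ler_expR; lra.
Qed.

End Mgf.

(** * Thin double cones are unlikely *)

Section Ratio.
Variables (R : realType).

(** Two of the rotated copies of the double cone |p| <= t |q| meet only at the
   origin: with r = D p - S q and r' = D' p - S' q, the vector (p, q) times the
   determinant D S' - D' S, which is at least 2, is a combination of r and r'. *)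
Lemma cones_disjoint (c c' K t p q : R) : 0 <= c -> c + 1 <= c' ->
  1 + c' ^+ 2 <= K -> 0 <= t -> 2 * t * K ^+ 2 <= 1 ->
  `|(1 - c ^+ 2) * p - 2 * c * q| <= t * `|(c ^+ 2 - 1) * q - 2 * c * p| ->
  `|(1 - c' ^+ 2) * p - 2 * c' * q| <= t * `|(c' ^+ 2 - 1) * q - 2 * c' * p| ->
  (1 + c ^+ 2) ^+ 2 * (p ^+ 2 + q ^+ 2) = 0.
Proof.
move=> c0 cc K1 t0 tK h h'.
have sq (a b : R) : `|a| <= t * `|b| -> a ^+ 2 <= t ^+ 2 * b ^+ 2.
  move=> ab; rewrite -[a ^+ 2]real_normK ?num_real // -[b ^+ 2]real_normK ?num_real //.
  by rewrite -exprMn ler_sqr ?nnegrE ?mulr_ge0.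
pose rho := p ^+ 2 + q ^+ 2.
have rho0 : 0 <= rho by rewrite addr_ge0 ?sqr_ge0.
pose D := 1 - c ^+ 2; pose S := 2 * c; pose D' := 1 - c' ^+ 2; pose S' := 2 * c'.
pose r := D * p - S * q; pose r' := D' * p - S' * q.
have K0 : 0 <= K by nra.
have N1 : D ^+ 2 + S ^+ 2 <= K ^+ 2.
  rewrite (_ : _ + _ = (1 + c ^+ 2) ^+ 2); last by rewrite /D /S; ring.
  by rewrite ler_sqr ?nnegrE //; nra.
have N2 : D' ^+ 2 + S' ^+ 2 <= K ^+ 2.
  rewrite (_ : _ + _ = (1 + c' ^+ 2) ^+ 2); last by rewrite /D' /S'; ring.
  by rewrite ler_sqr ?nnegrE //; nra.
have R1 : r ^+ 2 <= t ^+ 2 * (K ^+ 2 * rho).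
  apply: le_trans (sq _ _ h) _; rewrite ler_wpM2l ?sqr_ge0 //.
  apply: le_trans (ler_wpM2r rho0 N1).
  rewrite -subr_ge0 (_ : _ - _ = r ^+ 2) ?sqr_ge0 //.
  by rewrite /rho /r /D /S; ring.
have R2 : r' ^+ 2 <= t ^+ 2 * (K ^+ 2 * rho).
  apply: le_trans (sq _ _ h') _; rewrite ler_wpM2l ?sqr_ge0 //.
  apply: le_trans (ler_wpM2r rho0 N2).
  rewrite -subr_ge0 (_ : _ - _ = r' ^+ 2) ?sqr_ge0 //.
  by rewrite /rho /r' /D' /S'; ring.
have key : (D * S' - D' * S) ^+ 2 * rho = (r * S' - r' * S) ^+ 2 + (r * D' - r' * D) ^+ 2.
  by rewrite /rho /r /r'; ring.
have det : 4 <= (D * S' - D' * S) ^+ 2.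
  have : 2 <= D * S' - D' * S.
    rewrite (_ : _ - _ = 2 * (c' - c) * (1 + c * c')); last by rewrite /D /D' /S /S'; ring.
    have x0 : 0 <= c * c' by rewrite mulr_ge0 //; lra.
    have y1 : 1 <= c' - c by lra.
    by set x := c * c' in x0 *; set y := c' - c in y1 *; nra.
  by nra.
have up : (r * S' - r' * S) ^+ 2 + (r * D' - r' * D) ^+ 2 <=
    2 * (r ^+ 2 * (D' ^+ 2 + S' ^+ 2) + r' ^+ 2 * (D ^+ 2 + S ^+ 2)).
  rewrite -subr_ge0 (_ : _ - _ = (r * S' + r' * S) ^+ 2 + (r * D' + r' * D) ^+ 2).
    by rewrite addr_ge0 ?sqr_ge0.
  by ring.
have B1 : r ^+ 2 * (D' ^+ 2 + S' ^+ 2) <= t ^+ 2 * (K ^+ 2 * rho) * K ^+ 2.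
  by apply: ler_pM => //; rewrite ?sqr_ge0 // addr_ge0 ?sqr_ge0.
have B2 : r' ^+ 2 * (D ^+ 2 + S ^+ 2) <= t ^+ 2 * (K ^+ 2 * rho) * K ^+ 2.
  by apply: ler_pM => //; rewrite ?sqr_ge0 // addr_ge0 ?sqr_ge0.
have tK2 : t ^+ 2 * (K ^+ 2 * rho) * K ^+ 2 <= rho / 4.
  rewrite (_ : _ * _ = (2 * t * K ^+ 2) ^+ 2 * (rho / 4)); last by field.
  rewrite -[leRHS]mul1r ler_wpM2r ?divr_ge0 //.
  by rewrite expr_le1 // ?mulr_ge0 // sqr_ge0.
have : 4 * rho <= rho.
  apply: le_trans (ler_wpM2r rho0 det) _; rewrite key.
  by apply: le_trans up _; lra.
move=> h4; have -> : p ^+ 2 + q ^+ 2 = 0 by rewrite -/rho; lra.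
by rewrite mulr0.
Qed.

Variables (n : nat) (nu : probability 'cV[R]_n R).
Hypothesis hnu : uniform_on_sphere nu.

(** The apex v_i = v_j = 0 has to be excluded, as it lies in all rotated copies. *)
Definition cone (i j : 'I_n) (t : R) : set 'cV[R]_n :=
  [set v | (`|v i ord0| <= t * `|v j ord0|) && (v j ord0 != 0)].

Lemma measurable_cone i j t : measurable (cone i j t).
Proof.
have mc l : measurable_fun setT (fun v : 'cV[R]_n => v l ord0) by exact: measurable_coord.
have mn l : measurable_fun setT (fun v : 'cV[R]_n => `|v l ord0|).
  exact: measurableT_comp.
rewrite [X in measurable X](_ : _ = setT `&` (fun v : 'cV[R]_n =>
   (`|v i ord0| <= t * `|v j ord0|) && (v j ord0 != 0)) @^-1` [set true]); last first.
  by rewrite setTI; apply/seteqP; split.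
apply: measurable_and => //.
- by apply: measurable_fun_ler => //; exact: measurable_funM.
- apply: measurable_neg; exact: measurable_fun_eqr.
Qed.

Lemma reflection_coord (i j l : 'I_n) (c : R) (v : 'cV[R]_n) : i != j ->
  (c ^+ 2 + 1) * (reflection (c *: basisv R i + basisv R j) *m v) l ord0 =
  (c ^+ 2 + 1) * v l ord0 - 2 * (c * v i ord0 + v j ord0) * (c * (l == i)%:R + (l == j)%:R).
Proof.
move=> ij; set w := c *: _ + _.
have wv u : dotv w u = c * u i ord0 + u j ord0.
  by rewrite dotvDl dotvZl !(dotvC _ u) !dotv_basisv.
have wl : w l ord0 = c * (l == i)%:R + (l == j)%:R by rewrite !mxE !andbT.
have ww : dotv w w = c ^+ 2 + 1.
  by rewrite wv !mxE !eqxx /= (negbTE ij) eq_sym (negbTE ij) /=; ring.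
have c1 : c ^+ 2 + 1 != 0 by rewrite gt_eqF // ltr_pwDr // sqr_ge0.
by clearbody w; rewrite reflectionE !mxE wl ww wv; field.
Qed.

(** The reflections along c e_i + e_j, for c = 0, ..., N - 1, carry the double
    cone to N disjoint sets of the same probability. *)
Lemma cone_measure_le (N : nat) (i j : 'I_n) (t : R) : i != j -> 0 <= t ->
  2 * t * (1 + N%:R ^+ 2) ^+ 2 <= 1 ->
  (N%:R%:E * nu (cone i j t) <= 1)%E.
Proof.
move=> ij t0 tN.
pose Q (c : nat) := reflection (c%:R *: basisv R i + basisv R j).
have w0 (c : nat) : c%:R *: basisv R i + basisv R j != 0 :> 'cV[R]_n.
  apply/eqP => /(congr1 (fun w : 'cV[R]_n => w j ord0)).
  by rewrite !mxE !andbT eqxx [j == i]eq_sym (negbTE ij) mulr0 add0r => /eqP; rewrite oner_eq0.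
have mC := measurable_cone i j t.
have mI : measurable_fun setT (\1_(cone i j t) : 'cV[R]_n -> R) by exact: measurable_indic.
have I0 v : 0 <= \1_(cone i j t) v :> R by rewrite indicE.
have -> : (N%:R%:E * nu (cone i j t) =
    \sum_(c < N) \int[nu]_v (\1_(cone i j t) (Q c *m v))%:E)%E.
  rewrite (eq_bigr (fun=> nu (cone i j t))).
    by rewrite sumr_const card_ord mule_natl.
  move=> c _; rewrite (integral_orthogonal hnu (reflection_orthogonal (w0 c)) mI) //.
  by rewrite integral_indic // setIT.
have mIQ c : measurable_fun setT (fun v => \1_(cone i j t) (Q c *m v) : R).
  by apply: measurableT_comp => //; exact: measurable_mulmx.
rewrite -(ge0_integral_sum nu measurableT (f := fun (c : 'I_N) v => (\1_(cone i j t) (Q c *m v))%:E)); first last.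
- by move=> c v _; rewrite lee_fin.
- by move=> c; apply/measurable_EFinP.
rewrite -(integral_const nu 1).
under eq_integral do rewrite sumEFin.
apply: sphere_le_integral => //.
- exact: measurable_sum.
- by move=> v; exact: sumr_ge0.
move=> v _.
have coneE (c : nat) : cone i j t (Q c *m v) ->
    `|(1 - c%:R ^+ 2) * v i ord0 - 2 * c%:R * v j ord0| <=
      t * `|(c%:R ^+ 2 - 1) * v j ord0 - 2 * c%:R * v i ord0| /\
    (c%:R ^+ 2 - 1) * v j ord0 - 2 * c%:R * v i ord0 != 0.
  have c1 : 0 < c%:R ^+ 2 + 1 :> R by rewrite ltr_pwDr // sqr_ge0.
  have Ei : (1 - c%:R ^+ 2) * v i ord0 - 2 * c%:R * v j ord0 = (c%:R ^+ 2 + 1) * (Q c *m v) i ord0.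
    by rewrite reflection_coord // eqxx (negbTE ij) mulr0n mulr1n; ring.
  have Ej : (c%:R ^+ 2 - 1) * v j ord0 - 2 * c%:R * v i ord0 = (c%:R ^+ 2 + 1) * (Q c *m v) j ord0.
    by rewrite reflection_coord // eqxx [j == i]eq_sym (negbTE ij) mulr0n mulr1n; ring.
  move=> /andP[h1 h2]; rewrite Ei Ej; split.
    by rewrite !normrM mulrCA ler_pM2l // normr_gt0 gt_eqF.
  by rewrite mulf_neq0 // gt_eqF.
have disj (c c' : nat) : (c < c' < N)%N -> cone i j t (Q c *m v) -> cone i j t (Q c' *m v) -> False.
  move=> /andP[cc cN] /coneE[h1 h2] /coneE[h1' h2'].
  have : (1 + c%:R ^+ 2) ^+ 2 * ((v i ord0) ^+ 2 + (v j ord0) ^+ 2) = 0.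
    apply: (@cones_disjoint c%:R c'%:R (1 + N%:R ^+ 2) t) => //.
    - by rewrite natr1 ler_nat.
    - by rewrite lerD2l ler_sqr ?nnegrE // ler_nat ltnW.
  move/eqP; rewrite mulf_eq0 sqrf_eq0 gt_eqF ?ltr_pwDl ?sqr_ge0 //=.
  rewrite paddr_eq0 ?sqr_ge0 // !sqrf_eq0 => /andP[/eqP p0 /eqP q0].
  by move: h2; rewrite p0 q0 !mulr0 subrr eqxx.
have [/existsP[c /asboolP hc]|/existsPn h] := boolP [exists c : 'I_N, `[< cone i j t (Q c *m v) >]].
  rewrite (bigD1 c) //= big1 ?addr0; first by rewrite indicE mem_set.
  move=> c' cc'; rewrite indicE memNset // => hc'.
  have [lt|lt|/val_inj e] := ltngtP c c'.
  - by apply: disj hc hc'; rewrite lt ltn_ord.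
  - by apply: disj hc' hc; rewrite lt ltn_ord.
  - by rewrite e eqxx in cc'.
rewrite big1 // => c _; rewrite indicE memNset // => hc.
by have /asboolPn := h c; apply.
Qed.

End Ratio.

(** * Anti-concentration of the marginals *)

Section Block.
Variables (R : realType) (n : nat) (nu : probability 'cV[R]_n R).
Hypothesis hnu : uniform_on_sphere nu.
Hypothesis n0 : (0 < n)%N.
Local Notation s i v := (sproj v (basisv R i)).

Let mX (k : nat) (w : 'cV[R]_n) : measurable_fun setT (fun v => sproj v w ^+ k).
Proof. by apply: measurable_funX; exact: measurable_sproj. Qed.

(** Squares of distinct coordinates are not positively correlated (sproj_cross),
    so that the variance of the sum is at most the sum of the fourth moments. *)
Lemma block_variance (k : nat) (phi : 'I_k -> 'I_n) : injective phi ->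
  (\int[nu]_v ((k%:R - \sum_l s (phi l) v ^+ 2) ^+ 2)%:E <=
     (k%:R * fourth_bound R)%:E)%E.
Proof.
move=> phi_inj; pose Y v := \sum_l s (phi l) v ^+ 2.
have mY : measurable_fun setT Y by apply: measurable_sum => l; exact: mX.
have Y0 v : 0 <= Y v by apply: sumr_ge0 => l _; exact: sqr_ge0.
have EY : (\int[nu]_v (Y v)%:E = k%:R%:E)%E.
  rewrite /Y; under eq_integral do rewrite -sumEFin.
  rewrite (ge0_integral_sum nu measurableT (f := fun (l : 'I_k) v => (s (phi l) v ^+ 2)%:E)); first last.
  - by move=> l v _; rewrite lee_fin sqr_ge0.
  - by move=> l; apply/measurable_EFinP; exact: mX.
  rewrite (eq_bigr (fun=> 1%:E)); last by move=> l _; rewrite (sproj_second hnu n0 (unit_basisv _ _)).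
  by rewrite sumEFin sumr_const card_ord.
have EY2 : (\int[nu]_v (Y v ^+ 2)%:E <= (k%:R * fourth_bound R + k%:R ^+ 2)%:E)%E.
  pose F (p : 'I_k * 'I_k) v := s (phi p.1) v ^+ 2 * s (phi p.2) v ^+ 2.
  have YE v : Y v ^+ 2 = \sum_p F p v.
    by rewrite expr2 /Y big_distrlr /= pair_bigA.
  have mF p : measurable_fun setT (F p) by apply: measurable_funM; exact: mX.
  have F0 p v : 0 <= F p v by rewrite mulr_ge0 ?sqr_ge0.
  under eq_integral do rewrite YE -sumEFin.
  rewrite (ge0_integral_sum nu measurableT (f := fun p v => (F p v)%:E)); first last.
  - by move=> p v _; rewrite lee_fin.
  - by move=> p; apply/measurable_EFinP.
  apply: (@le_trans _ _ (\sum_(p : 'I_k * 'I_k) ((p.1 == p.2)%:R * fourth_bound R + 1)%:E)%E).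
    apply: lee_sum => -[p q] _ /=; rewrite /F /=.
    have [->|pq] := eqVneq p q.
      under eq_integral do rewrite -exprD.
      apply: le_trans (sproj_fourth hnu n0 (unit_basisv _ _)) _.
      by rewrite lee_fin mulr1n mul1r lerDl.
    by rewrite mulr0n mul0r add0r sproj_cross // (inj_eq phi_inj).
  rewrite sumEFin lee_fin big_split /= -mulr_suml sumr_const card_prod card_ord.
  rewrite -(pair_bigA _ (fun p q : 'I_k => (p == q)%:R)) /=.
  rewrite (eq_bigr (fun=> 1)); last first.
    move=> p _; rewrite (bigD1 p) //= eqxx big1 ?addr0 // => q.
    by rewrite eq_sym => /negbTE ->.
  by rewrite sumr_const card_ord natrM expr2.
have H : (\int[nu]_v ((k%:R - Y v) ^+ 2 + 2 * k%:R * Y v)%:E =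
    \int[nu]_v (k%:R ^+ 2 + Y v ^+ 2)%:E)%E.
  by apply: eq_integral => v _; congr EFin; ring.
have mkY : measurable_fun setT (fun v => (k%:R - Y v) ^+ 2).
  by apply: measurable_funX; exact: measurable_funB.
have mY2 : measurable_fun setT (fun v => Y v ^+ 2) by exact: measurable_funX.
move: H; under eq_integral do rewrite EFinD [(2 * _ * _)%:E]EFinM.
under [X in _ = X]eq_integral do rewrite EFinD.
rewrite ge0_integralD //; first last.
- by apply: measurable_funeM; apply/measurable_EFinP.
- by move=> v _; rewrite -EFinM lee_fin !mulr_ge0.
- by apply/measurable_EFinP.
- by move=> v _; rewrite lee_fin sqr_ge0.
rewrite ge0_integralD //; first last.
- by apply/measurable_EFinP.
- by move=> v _; rewrite lee_fin sqr_ge0.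
rewrite ge0_integralZl_EFin ?mulr_ge0 //; last by apply/measurable_EFinP.
rewrite EY (integral_const nu (k%:R ^+ 2)).
have [r r0 Er] := integral_fin (fun v => sqr_ge0 (Y v)) EY2.
move: EY2; rewrite Er lee_fin => rM.
have : (0 <= \int[nu]_v ((k%:R - Y v) ^+ 2)%:E)%E.
  by apply: integral_ge0 => v _; rewrite lee_fin sqr_ge0.
rewrite -/Y; case: (\int[nu]_v ((k%:R - Y v) ^+ 2)%:E)%E => [c| |] //.
  rewrite -EFinM -!EFinD lee_fin => _ [cE]; rewrite lee_fin.
  by move: rM cE; rewrite expr2; lra.
by move=> v _; rewrite lee_fin.
Qed.

End Block.

Section SmallBall.
Variable R : realType.

Definition band (t : R) : set R := [set r | `|r| <= t].

Lemma measurable_band t : measurable (band t).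
Proof.
rewrite (_ : band t = `[- t, t]%classic) //.
by apply/seteqP; split => r /=; rewrite /band /= in_itv /= ler_norml.
Qed.

(** Anti-concentration of a marginal, uniformly in the dimension. If |v_0| is
    small then either it is much smaller than some other |v_i|, which confines v
    to a thin double cone, or many coordinates are small at the same time, which
    the normalization |v| = 1 (few coordinates) or Chebyshev's inequality (k
    coordinates out of many) makes unlikely. *)
Lemma small_ball (p0 : R) : 0 < p0 -> exists2 t : R, 0 < t &
  forall (n : nat) (nu : probability 'cV[R]_n R) (u : 'cV[R]_n), (0 < n)%N ->
  uniform_on_sphere nu -> unit_sphere u ->
  (\int[nu]_v (\1_(band t) (sproj v u))%:E <= p0%:E)%E.
Proof.
move=> p00.
(* With k, Chebyshev's bound 4 M / k is at most p0 / 2, M being the bound on the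
   fourth moment; with N, the k cones contribute at most k / N <= p0 / 2. The
   aperture tau is the one that cone_measure_le allows for N. *)
pose k := (Num.truncn (8 * fourth_bound R / p0)).+1.
have kM : 8 * fourth_bound R / p0 < k%:R by exact: truncnS_gt.
pose N := (Num.truncn (2 * k%:R / p0)).+1.
have kN : 2 * k%:R / p0 < N%:R by exact: truncnS_gt.
have N0 : 0 < N%:R :> R by rewrite ltr0n.
have k0 : 0 < k%:R :> R by rewrite ltr0n.
pose K : R := (1 + N%:R ^+ 2) ^+ 2.
have K0 : 0 < K by rewrite exprn_gt0 // ltr_pwDl // sqr_ge0.
pose tau := (2 * K)^-1.
have tau0 : 0 < tau by rewrite invr_gt0 mulr_gt0.
have K1 : 1 <= K by rewrite /K exprn_ege1 // lerDl sqr_ge0.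
have tau1 : tau <= 1 / 2 by rewrite /tau invfM -[leRHS]mulrC ler_wpM2l // invf_le1.
have tauK : 2 * tau * K <= 1 by rewrite /tau; rewrite le_eqVlt; apply/orP; left; apply/eqP; field; rewrite gt_eqF.
exists (tau / 2); first by rewrite divr_gt0.
move=> [//|n] nu u _ hnu u1.
have mb := measurable_band (tau / 2).
pose s (i : 'I_n.+1) v := sproj v (basisv R i).
have ms i : measurable_fun setT (s i) by exact: measurable_sproj.
have mI : measurable_fun setT (\1_(band (tau / 2)) : R -> R) by exact: measurable_indic.
have I0 r : 0 <= \1_(band (tau / 2)) r :> R by rewrite indicE.
rewrite (integral_sproj_unit hnu u1 (unit_basisv R ord0) mI I0).
have m1 : measurable_fun setT (fun v : 'cV[R]_n.+1 => \1_(band (tau / 2)) (sproj v (basisv R ord0)) : R).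
  by apply: (measurableT_comp mI); exact: measurable_sproj.
have sn : 0 < Num.sqrt n.+1%:R :> R by rewrite sqrtr_gt0 ltr0n.
have cone_in i v : s ord0 v ^+ 2 <= (tau / 2) ^+ 2 -> 1 / 4 <= s i v ^+ 2 -> cone ord0 i tau v.
  rewrite /s /sproj !dotv_basisv => h1 h2.
  have hn : 1 / 2 <= `|Num.sqrt n.+1%:R * v i ord0|.
    rewrite -(ler_pXn2r (ltn0Sn 1)) ?nnegrE // real_normK ?num_real //.
    by apply: le_trans h2; lra.
  have hn0 : `|Num.sqrt n.+1%:R * v ord0 ord0| <= tau / 2.
    by rewrite -(ler_pXn2r (ltn0Sn 1)) ?nnegrE ?divr_ge0 ?(ltW tau0) // real_normK ?num_real.
  apply/andP; split; last first.
    by apply: contraTneq hn => ->; rewrite mulr0 normr0 -ltNge; lra.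
  rewrite -(ler_pM2l sn) mulrCA -{1 2}[Num.sqrt _]gtr0_norm // -!normrM.
  by apply: le_trans hn0 _; rewrite ler_pM2l //; lra.
have bandP v : \1_(band (tau / 2)) (s ord0 v) = 1 :> R -> s ord0 v ^+ 2 <= (tau / 2) ^+ 2.
  rewrite indicE; case: (boolP (_ \in _)) => [|_ /eqP]; last by rewrite eq_sym oner_eq0.
  rewrite inE /band /= => h _; rewrite -[leLHS]real_normK ?num_real //.
  by rewrite ler_sqr ?nnegrE // divr_ge0 // ltW.
have coneN i : i != ord0 -> (nu (cone ord0 i tau) <= N%:R^-1%:E)%E.
  rewrite eq_sym => i0; have := cone_measure_le hnu i0 (ltW tau0) tauK.
  have : (0 <= nu (cone ord0 i tau))%E by exact: measure_ge0.
  case: (nu _) => [r| |] //; last by rewrite gt0_muley ?lte_fin.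
  by rewrite -EFinM !lee_fin => r0 Nr; rewrite -[leRHS]mul1r ler_pdivlMr // mulrC.
have mcone i : measurable_fun setT (\1_(cone ord0 i tau) : 'cV[R]_n.+1 -> R).
  by apply: measurable_indic; exact: measurable_cone.
have kNp : k%:R * N%:R^-1 <= p0 / 2.
  by rewrite ler_pdivrMr //; move: kN; rewrite ltr_pdivrMr //; lra.
have cones (m : nat) (phi : 'I_m -> 'I_n.+1) : (m <= k)%N -> (forall l, phi l != ord0) ->
    (\int[nu]_v (\sum_l \1_(cone ord0 (phi l) tau) v)%:E <= (p0 / 2)%:E)%E.
  move=> mk phi0; under eq_integral do rewrite -sumEFin.
  rewrite (ge0_integral_sum nu measurableT (f := fun (l : 'I_m) v => (\1_(cone ord0 (phi l) tau) v)%:E)); first last.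
  - by move=> l v _; rewrite lee_fin.
  - by move=> l; apply/measurable_EFinP.
  apply: (@le_trans _ _ (\sum_(l < m) N%:R^-1%:E)%E).
    apply: lee_sum => l _; rewrite integral_indic // ?setIT; last exact: measurable_cone.
    exact: coneN.
  rewrite sumEFin lee_fin sumr_const card_ord -[leLHS]mulr_natl.
  by apply: le_trans kNp; rewrite ler_wpM2r ?invr_ge0 ?ler0n // ler_nat.
have [nk|kn] := leqP n k.
  apply: (@le_trans _ _ (p0 / 2)%:E); last by rewrite lee_fin; lra.
  apply: le_trans (cones n (lift ord0) nk _); last by move=> l; rewrite eq_sym neq_lift.
  apply: sphere_le_integral => //.
  - exact: measurable_sum.
  - by move=> v; exact: sumr_ge0.
  move=> v v1; rewrite -/(s ord0 v); have := bandP v; rewrite indicE; case: (boolP (_ \in _)) => [_|_ _]; last exact: sumr_ge0.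
  move=> /(_ erefl) h0.
  have [/existsP[l hl]|/existsPn h] := boolP [exists l : 'I_n, 1 / 4 <= s (lift ord0 l) v ^+ 2].
    rewrite (bigD1 l) //= indicE mem_set /=; first by rewrite lerDl sumr_ge0.
    exact: cone_in.
  have := sum_sproj_sq v1; rewrite big_ord_recl -/(s ord0 v).
  have : \sum_(i < n) sproj v (basisv R (lift ord0 i)) ^+ 2 <= \sum_(i < n) 1 / 4.
    by apply: ler_sum => i _; have := h i; rewrite -ltNge => /ltW.
  rewrite sumr_const card_ord -[_ *+ n]mulr_natl.
  have n1 : n.+1%:R = n%:R + 1 :> R by rewrite natr1.
  have : 0 <= n%:R :> R by [].
  have : (tau / 2) ^+ 2 <= 1 / 2 by rewrite expr2; nra.
  by rewrite n1; move: h0 => *; exfalso; lra.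
pose phi (l : 'I_k) := lift ord0 (widen_ord (ltnW kn) l).
have phi_inj : injective phi.
  by move=> l l' /lift_inj /(congr1 val) /= /val_inj.
pose G v := 4 / k%:R ^+ 2 * (k%:R - \sum_l s (phi l) v ^+ 2) ^+ 2.
have c0 : 0 <= 4 / k%:R ^+ 2 :> R by rewrite divr_ge0 ?sqr_ge0.
have mV : measurable_fun setT (fun v => (k%:R - \sum_l s (phi l) v ^+ 2) ^+ 2).
  apply: measurable_funX; apply: measurable_funB => //.
  by apply: measurable_sum => l; exact: measurable_funX.
have mG : measurable_fun setT G by exact: measurable_funM.
have G0 v : 0 <= G v by rewrite mulr_ge0 // sqr_ge0.
have mC : measurable_fun setT (fun v => \sum_l \1_(cone ord0 (phi l) tau) v : R) by exact: measurable_sum.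
have C0 v : 0 <= \sum_l \1_(cone ord0 (phi l) tau) v :> R by exact: sumr_ge0.
apply: (@le_trans _ _ (\int[nu]_v (\sum_l \1_(cone ord0 (phi l) tau) v + G v)%:E)%E).
  apply: sphere_le_integral => //.
  - exact: measurable_funD.
  - by move=> v; rewrite addr_ge0.
  move=> v v1; rewrite -/(s ord0 v); have := bandP v; rewrite indicE; case: (boolP (_ \in _)) => [_|_ _]; last exact: addr_ge0.
  move=> /(_ erefl) h0.
  have [/existsP[l hl]|/existsPn h] := boolP [exists l : 'I_k, 1 / 4 <= s (phi l) v ^+ 2].
    rewrite (bigD1 l) //= indicE mem_set /=; last exact: cone_in.
    by rewrite -addrA lerDl addr_ge0 // sumr_ge0.
  rewrite -[1%:R]add0r lerD // /G.
  have : \sum_l s (phi l) v ^+ 2 <= \sum_(l < k) 1 / 4.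
    by apply: ler_sum => l _; have := h l; rewrite -ltNge => /ltW.
  rewrite sumr_const card_ord -[_ *+ k]mulr_natl => hY.
  rewrite mulrAC ler_pdivlMr ?exprn_gt0 // mul1r.
  by set Y := \sum_l _ in hY *; nra.
under eq_integral do rewrite EFinD.
rewrite ge0_integralD //; first last.
- by apply/measurable_EFinP.
- by move=> v _; rewrite lee_fin.
- by apply/measurable_EFinP.
- by move=> v _; rewrite lee_fin.
rewrite [p0]splitr EFinD leeD ?cones //.
rewrite /G; under eq_integral do rewrite EFinM.
rewrite ge0_integralZl_EFin //; first last.
- by apply/measurable_EFinP.
- by move=> v _; rewrite lee_fin sqr_ge0.
apply: le_trans (lee_wpmul2l _ (block_variance hnu (ltn0Sn n) phi_inj)) _.
  by rewrite lee_fin.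
rewrite -EFinM lee_fin.
rewrite (_ : 4 / k%:R ^+ 2 * _ = 4 * fourth_bound R / k%:R); last by field; rewrite gt_eqF.
rewrite ler_pdivrMr //; move: kM; rewrite ltr_pdivrMr //; lra.
Qed.

End SmallBall.

(** * Independence and Chernoff's method *)

Import HBNNSimple.
Section Chernoff.
Variables (R : realType) (d d' : measure_display) (T : measurableType d)
  (V : measurableType d') (P : probability T R) (ix : finType)
  (X : ix -> {mfun T >-> V}).
Hypothesis Xind : mutually_independent P X.

Let mX (h : V -> R) i : measurable_fun setT h -> measurable_fun setT (fun w => h (X i w)).
Proof. by move=> mh; apply: (measurableT_comp mh). Qed.

(** Expanding the product of the simple functions phi (X i) over all choices of
    values reduces the claim to the definition of independence. *)
Lemma integral_prod_indep_simple (K : nat) (r : 'I_K -> R) (B : 'I_K -> set V) :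
  (forall j, 0 <= r j) -> (forall j, measurable (B j)) ->
  let phi v := \sum_(j < K) r j * \1_(B j) v in
  (\int[P]_w (\prod_i phi (X i w))%:E = \prod_i \int[P]_w (phi (X i w))%:E)%E.
Proof.
move=> r0 mB phi.
pose p i j := fine (P (X i @^-1` B j)).
have mXB i j : measurable (X i @^-1` B j).
  by rewrite -[X in measurable X]setTI; exact: measurable_funPT.
have pE i j : P (X i @^-1` B j) = (p i j)%:E by rewrite fineK // fin_num_measure.
have mind i j : measurable_fun setT (fun w => r j * \1_(B j) (X i w)).
  by apply: measurable_funM => //; apply: mX; exact: measurable_indic.
have ind0 i j w : 0 <= r j * \1_(B j) (X i w) by rewrite mulr_ge0 // indicE.
have -> : (\prod_i \int[P]_w (phi (X i w))%:E = (\prod_i \sum_j r j * p i j)%:E)%E.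
  rewrite -prodEFin; apply: eq_bigr => i _.
  rewrite /phi; under eq_integral do rewrite -sumEFin.
  rewrite (ge0_integral_sum P measurableT (f := fun j w => (r j * \1_(B j) (X i w))%:E)); first last.
  - by move=> j w _; rewrite lee_fin.
  - by move=> j; apply/measurable_EFinP.
  rewrite -sumEFin; apply: eq_bigr => j _.
  under eq_integral do rewrite EFinM.
  rewrite ge0_integralZl_EFin //; last first.
    by apply/measurable_EFinP; apply: mX; exact: measurable_indic.
  rewrite (_ : (fun w => _) = (fun w => (\1_(X i @^-1` B j) w)%:E)) //.
  by rewrite integral_indic // setIT [X in (_ * X)%E](pE i j) -EFinM.
rewrite bigA_distr_bigA -sumEFin /=.
under eq_integral do rewrite /phi bigA_distr_bigA -sumEFin.
have mF (f : {ffun ix -> 'I_K}) :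
    measurable_fun setT (fun w => \prod_i (r (f i) * \1_(B (f i)) (X i w))).
  by apply: measurable_prod => i _; exact: mind.
rewrite (ge0_integral_sum P measurableT (f := fun (f : {ffun ix -> 'I_K}) w => (\prod_i (r (f i) * \1_(B (f i)) (X i w)))%:E)); first last.
- by move=> f w _; rewrite lee_fin prodr_ge0.
- by move=> f; apply/measurable_EFinP.
apply: eq_bigr => f _.
pose A := \bigcap_(i in [set` [set: ix]%SET]) (X i @^-1` B (f i)).
have mA : measurable A by apply: fin_bigcap_measurable => // i _; exact: mXB.
have AE w : \prod_i \1_(B (f i)) (X i w) = \1_A w :> R.
  rewrite [RHS]indicE; case: (boolP (w \in A)) => [|wA].
    rewrite inE => wA; rewrite big1 // => i _.
    by rewrite indicE mem_set //; apply: wA; rewrite /= finset.in_setT.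
  have [i wi] : exists i, ~ B (f i) (X i w).
    apply/existsNP => h; move/negP: wA; apply; rewrite inE => i _; exact: h.
  by rewrite (bigD1 i) //= indicE memNset // mul0r.
under eq_integral do rewrite big_split /= AE EFinM.
rewrite ge0_integralZl_EFin ?prodr_ge0 //; last first.
  by apply/measurable_EFinP; exact: measurable_indic.
rewrite integral_indic // setIT [X in (_ * X)%E](Xind (B := fun i => B (f i))) //.
rewrite (eq_bigr (fun i => (p i (f i))%:E)); last by move=> i _; rewrite pE.
rewrite [X in (_ * X)%E](eq_bigl xpredT); last by move=> i; rewrite finset.in_setT.
by rewrite prodEFin -EFinM big_split.
Qed.

(** By monotone convergence along simple functions that increase to h. *)
Lemma integral_prod_indep_le (h : V -> R) (b : R) :
  measurable_fun setT h -> (forall v, 0 <= h v) ->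
  (forall i, \int[P]_w (h (X i w))%:E <= b%:E)%E ->
  (\int[P]_w (\prod_i h (X i w))%:E <= (b ^+ #|ix|)%:E)%E.
Proof.
move=> mh h0 hb.
have mEh : measurable_fun setT (EFin \o h) by exact/measurable_EFinP.
pose phi (N : nat) : {nnsfun V >-> R} := nnsfun_approx measurableT mEh N.
have Eh0 v : setT v -> (0 <= (EFin \o h) v)%E by rewrite lee_fin.
have phi_nd (v : V) : {homo (fun N => phi N v) : N M / (N <= M)%N >-> N <= M}.
  by move=> N M NM; have /lefP := nd_nnsfun_approx measurableT mEh NM; apply.
have phi_cvg (v : V) : phi N v @[N --> \oo] --> h v.
  by have /fine_cvgP[] := cvg_nnsfun_approx measurableT mEh Eh0 (x := v) I.
have phi_le N (v : V) : phi N v <= h v.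
  have := nondecreasing_cvgn_le (phi_nd v) (cvgP _ (phi_cvg v)) N.
  by rewrite (cvg_lim _ (phi_cvg v)).
have mphi N i : measurable_fun setT (fun w => phi N (X i w)) by exact: mX.
have step N : (\int[P]_w (\prod_i phi N (X i w))%:E <= (b ^+ #|ix|)%:E)%E.
  pose r : seq R := finmap.enum_fset (fset_set (range (phi N))).
  have E (v : V) : phi N v = \sum_(j < size r) r`_j * \1_(phi N @^-1` [set r`_j]) v.
    have rv : phi N v \in r.
      by rewrite [_ \in _]in_fset_set ?inE //; exact: fimfunP.
    have jr : (index (phi N v) r < size r)%N by rewrite index_mem.
    rewrite (bigD1 (Ordinal jr)) //= big1 ?addr0.
      by rewrite indicE mem_set ?mulr1 ?nth_index.
    move=> j; rewrite -val_eqE /= => jne; rewrite indicE memNset ?mulr0 //=.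
    move=> ev; move: jne; rewrite ev index_uniq ?eqxx //.
    exact: finmap.fset_uniq.
  under eq_integral do under eq_bigr do rewrite E.
  rewrite (integral_prod_indep_simple (r := fun j => r`_j)
     (B := fun j : 'I_(size r) => phi N @^-1` [set r`_j])); first last.
  - by move=> j; rewrite -[X in measurable X]setTI; exact: measurable_funPT.
  - move=> j; have : r`_j \in r by rewrite mem_nth.
    rewrite [_ \in _]in_fset_set ?inE /=; last exact: fimfunP.
    by move=> [v _ <-].
  pose q i := fine (\int[P]_w (phi N (X i w))%:E).
  have q_le i : (\int[P]_w (phi N (X i w))%:E <= b%:E)%E.
    apply: le_trans (hb i); apply: ge0_le_integral => //.
    - by move=> w _; rewrite lee_fin.
    - exact/measurable_EFinP.
    - by apply/measurable_EFinP; exact: mX.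
    - by move=> w _; rewrite lee_fin.
  have q_ge i : (0 <= \int[P]_w (phi N (X i w))%:E)%E.
    by apply: integral_ge0 => w _; rewrite lee_fin.
  have qE i : (\int[P]_w (phi N (X i w))%:E = (q i)%:E)%E.
    by rewrite fineK // ge0_fin_numE // (le_lt_trans (q_le i)) // ltry.
  rewrite (eq_bigr (fun i => (q i)%:E)); last first.
    by move=> i _; rewrite -qE; apply: eq_integral => w _; rewrite E.
  rewrite prodEFin lee_fin -prodr_const; apply: ler_prod => i _.
  by rewrite -!lee_fin -qE q_ge q_le.
have mprod N : measurable_fun setT (fun w => \prod_i phi N (X i w)).
  by apply: measurable_prod => i _; exact: mphi.
have mc := @cvg_monotone_convergence _ _ _ P setT measurableT
  (fun N w => (\prod_i phi N (X i w))%:E) (fun N => (measurable_EFinP _ _).2 (mprod N)).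
have G0 N w : [set: T] w -> (0 <= (\prod_i phi N (X i w))%:E)%E.
  by move=> _; rewrite lee_fin prodr_ge0.
have Gnd w : [set: T] w ->
    {homo (fun N => (\prod_i phi N (X i w))%:E) : N M / (N <= M)%N >-> (N <= M)%E}.
  move=> _ N M NM; rewrite lee_fin; apply: ler_prod => i _.
  by rewrite phi_nd // andbT.
have {}mc := mc G0 Gnd.
have -> : (\int[P]_w (\prod_i h (X i w))%:E =
    \int[P]_w limn (fun N : nat => (\prod_i phi N (X i w))%:E))%E.
  apply: eq_integral => w _; apply/esym/cvg_lim => //.
  apply: cvg_EFin; first exact: nearW.
  by apply: (cvg_big (@mul_continuous R)) => i _; exact: phi_cvg.
rewrite -(cvg_lim _ mc) //; apply: lime_le; first by apply/cvg_ex; eexists; exact: mc.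
by apply: nearW => N; exact: step.
Qed.

(** Chernoff's method: Markov's inequality for exp of the sum, whose expectation
    factorizes by independence. *)
Lemma chernoff (f : V -> R) (c : R) : measurable_fun setT f ->
  (forall i, \int[P]_w (expR (f (X i w)))%:E <= (expR (- c))%:E)%E ->
  (P [set w | 0 <= \sum_i f (X i w)]%R <= (expR (- (#|ix|%:R * c)))%:E)%E.
Proof.
move=> mf fc; set A := [set w | _].
have mE : measurable_fun setT (fun v => expR (f v)) by exact: measurableT_comp.
have mS : measurable_fun setT (fun w => \sum_i f (X i w)).
  by apply: measurable_sum => i; exact: (mX i mf).
have mA : measurable A.
  rewrite /A (_ : [set w | _] = setT `&` (fun w => \sum_i f (X i w)) @^-1` `[0, +oo[%classic).
    exact: mS.
  by rewrite setTI; apply/seteqP; split => w /=; rewrite in_itv /= andbT.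
have := integral_prod_indep_le mE (fun v => expR_ge0 _) fc.
rewrite -expRM_natl mulrN; apply: le_trans.
rewrite -[A]setIT -integral_indic //; apply: ge0_le_integral => //.
- by apply/measurable_EFinP; exact: measurable_indic.
- by apply/measurable_EFinP; apply: measurable_prod => i _; exact: (mX i mE).
move=> w _; rewrite lee_fin -expR_sum indicE.
case: (boolP (_ \in _)) => [|_]; last exact: expR_ge0.
by rewrite inE /A /= => h; rewrite (le_trans _ (expR_ge1Dx _)) // lerDl.
Qed.

End Chernoff.

(** * A net of the sphere *)

Section Net.
Variable R : realType.

(** The number of cells is estimated by a generating function: a cell of total
    weight at most N n counts at least once in the sum of 2^(N n - weight). *)
Lemma card_cells (n N L : nat) :
  (#|[set f : {ffun 'I_n -> 'I_L * bool} | (\sum_i (f i).1 <= N * n)%N]%SET|%:R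
    <= (4 * 2 ^+ N) ^+ n :> R).
Proof.
set A := [set f | _]%SET.
pose w (p : 'I_L * bool) : R := 2^-1 ^+ p.1.
have w0 p : 0 <= w p by rewrite exprn_ge0.
have sumw : \sum_p w p <= 4.
  rewrite -(pair_bigA _ (fun (a : 'I_L) (b : bool) => 2^-1 ^+ a : R)) /=.
  rewrite (eq_bigr (fun a : 'I_L => 2 * 2^-1 ^+ a : R)); last first.
    by move=> a _; rewrite big_bool /=; lra.
  rewrite -mulr_sumr.
  have : (2^-1 ^+ L - 1 : R) = (2^-1 - 1) * \sum_(i < L) 2^-1 ^+ i by rewrite -subrX1.
  have : 0 <= 2^-1 ^+ L :> R by rewrite exprn_ge0.
  by lra.
apply: (@le_trans _ _ (2 ^+ (N * n) * \prod_(i < n) \sum_p w p)); last first.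
  rewrite exprM prodr_const card_ord -exprMn mulrC.
  by rewrite lerXn2r ?nnegrE ?mulr_ge0 ?exprn_ge0 ?sumr_ge0 // ler_wpM2r ?exprn_ge0.
rewrite bigA_distr_bigA /= mulr_sumr -sum1_card natr_sum big_mkcond /=.
apply: ler_sum => f _; case: ifPn => [|_]; last first.
  by rewrite mulr_ge0 ?exprn_ge0 // prodr_ge0.
rewrite inE => fA; rewrite /w prodrXr exprVn.
rewrite ler_pdivlMr ?exprn_gt0 // mul1r.
by apply: ler_weXn2l fA; lra.
Qed.

(** Rounding the coordinates of a unit vector to multiples of 1 / (N sqrt n)
    gives cells of diameter at most 1 / N; one point is kept from each cell that
    meets the sphere. *)
Lemma sphere_net (n N : nat) : (0 < n)%N -> (0 < N)%N ->
  exists s : seq 'cV[R]_n,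
    [/\ (size s)%:R <= (4 * 2 ^+ N) ^+ n :> R,
        forall v, v \in s -> unit_sphere v &
        forall u, unit_sphere u -> exists2 v, v \in s &
          dotv (u - v) (u - v) <= (N%:R ^+ 2)^-1].
Proof.
move=> n0 N0.
have nR : 0 < n%:R :> R by rewrite ltr0n.
have NR : 0 < N%:R :> R by rewrite ltr0n.
pose sq : R := Num.sqrt n%:R.
have sq0 : 0 < sq by rewrite sqrtr_gt0.
have sqn : sq ^+ 2 = n%:R by rewrite sqr_sqrtr // ltW.
pose a (u : 'cV[R]_n) i := Num.truncn (`|u i ord0| * sq * N%:R).
have a_itv u i : (a u i)%:R <= `|u i ord0| * sq * N%:R < (a u i).+1%:R.
  by apply: truncn_itv; rewrite !mulr_ge0 // ltW.
have a_sum u : unit_sphere u -> (\sum_i a u i <= N * n)%N.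
  move=> /unit_sphereE; rewrite dotvE => u1.
  rewrite -(ler_nat R) natr_sum natrM.
  apply: (@le_trans _ _ (\sum_i (N%:R * ((n%:R * (u i ord0 * u i ord0) + 1) / 2)))).
    apply: ler_sum => i _; have /andP[h _] := a_itv u i; apply: le_trans h _.
    rewrite mulrC ler_pM2l // -sqn.
    have := sqr_ge0 (`|u i ord0| * sq - 1); have := real_normK (num_real (u i ord0)).
    by rewrite !expr2; nra.
  rewrite -mulr_sumr ler_pM2l // -mulr_suml big_split /= -mulr_sumr u1.
  by rewrite sumr_const card_ord; lra.
pose cell u : {ffun 'I_n -> 'I_(N * n).+1 * bool} := [ffun i => (inord (a u i), 0 <= u i ord0)].
have cell_a u i : unit_sphere u -> ((cell u i).1 : nat) = a u i.
  move=> u1; rewrite ffunE /= inordK // ltnS (leq_trans _ (a_sum u u1)) //.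
  by rewrite (bigD1 i) //= leq_addr.
pose A := [set f : {ffun 'I_n -> 'I_(N * n).+1 * bool} | (\sum_i (f i).1 <= N * n)%N]%SET.
pose occ (f : {ffun 'I_n -> 'I_(N * n).+1 * bool}) := [set u : 'cV[R]_n | unit_sphere u /\ cell u = f].
pose s := [seq xget 0 (occ f) | f <- enum A & `[< occ f !=set0 >]].
have rep f : occ f !=set0 -> occ f (xget 0 (occ f)) by move=> [u uf]; exact: xgetPex (ex_intro _ u uf).
exists s; split.
- apply: le_trans (card_cells n N (N * n).+1).
  by rewrite ler_nat size_map size_filter cardE count_size.
- by move=> v /mapP[f]; rewrite mem_filter => /andP[/asboolP /rep[fv _] _] ->.
move=> u u1; have ou : occ (cell u) u by [].
exists (xget 0 (occ (cell u))).
  apply/mapP; exists (cell u) => //; rewrite mem_filter; apply/andP; split.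
    by apply/asboolP; exists u.
  rewrite mem_enum inE (eq_bigr (a u)); first exact: a_sum.
  by move=> i _; rewrite cell_a.
have [v1 vu] := rep _ (ex_intro _ u ou); move: v1 vu; set v := xget _ _ => v1 vu.
rewrite dotvE.
apply: (@le_trans _ _ (\sum_(i < n) (n%:R * N%:R ^+ 2)^-1)); last first.
  by rewrite sumr_const card_ord -[leLHS]mulr_natl invfM mulrA mulfV ?gt_eqF // mul1r.
apply: ler_sum => i _.
have av : a v i = a u i by rewrite -!cell_a // vu.
have sg : (0 <= v i ord0) = (0 <= u i ord0).
  by have := congr1 (fun f : {ffun 'I_n -> 'I_(N * n).+1 * bool} => (f i).2) vu; rewrite !ffunE.
have /andP[] := a_itv v i; have /andP[] := a_itv u i; rewrite av -natr1.
move=> h1 h2 h3 h4; rewrite -[leRHS]mul1r ler_pdivlMr ?mulr_gt0 ?exprn_gt0 // !mxE -sqn -exprMn -expr2 -exprMn.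
have dd : (u i ord0 - v i ord0) * (sq * N%:R) = u i ord0 * sq * N%:R - v i ord0 * sq * N%:R by ring.
have le1 : `|(u i ord0 - v i ord0) * (sq * N%:R)| <= 1.
  rewrite dd ler_norml; have [u0|u0] := leP 0 (u i ord0).
    have v0 : 0 <= v i ord0 by rewrite sg.
    by move: h1 h2 h3 h4; rewrite !ger0_norm // => *; apply/andP; split; lra.
  have v0 : v i ord0 < 0 by rewrite ltNge sg -ltNge.
  move: h1 h2 h3 h4; rewrite !ltr0_norm // !mulNr => *; apply/andP; split; lra.
by rewrite -[leLHS]real_normK ?num_real // expr_le1.
Qed.

End Net.

(** * From a net to all directions and all wedges *)

Section Deterministic.
Variables (R : realType) (n m : nat).
Implicit Types (u v x y z : 'cV[R]_n).

Lemma sprojD v x y : sproj v (x + y) = sproj v x + sproj v y.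
Proof. by rewrite /sproj dotvDr mulrDr. Qed.

Lemma sprojZ v c y : sproj v (c *: y) = c * sproj v y.
Proof. by rewrite /sproj dotvZr mulrCA. Qed.

Lemma sprojB v x y : sproj v (x - y) = sproj v x - sproj v y.
Proof. by rewrite sprojD -scaleN1r sprojZ mulN1r. Qed.

Lemma excess_sq_le (t r : R) : 0 <= t -> r ^+ 2 <= 4 * t ^+ 2 + 4 * excess t r ^+ 2.
Proof.
move=> t0; rewrite /excess -[r ^+ 2]real_normK ?num_real //.
have r0 := normr_ge0 r; have [h|h] := leP (`|r| - t) 0; first by nra.
have [h2|h2] := leP `|r| (2 * t); first by nra.
by nra.
Qed.

Lemma excess_sqD_le (t p q : R) :
  excess t (p + q) ^+ 2 <= 2 * excess t p ^+ 2 + 2 * q ^+ 2.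
Proof.
have e0 := excess_ge0 t p.
have h : excess t (p + q) <= excess t p + `|q|.
  rewrite {1}/excess ge_max addr_ge0 ?excess_ge0 // andbT.
  have : `|p| - t <= excess t p by rewrite /excess le_max lexx.
  by have := ler_normD p q; lra.
have h1 := excess_ge0 t (p + q).
rewrite -[q ^+ 2]real_normK ?num_real //; have := normr_ge0 q.
set a := excess t p in e0 h *; set b := excess t (p + q) in h h1 *; set c := `|q| => c0.
have : b ^+ 2 <= (a + c) ^+ 2 by rewrite ler_sqr ?nnegrE ?addr_ge0.
by have := sqr_ge0 (a - c); rewrite !expr2; nra.
Qed.

(** For unit vectors, |x - z|^2 = 2 - 2 cos (angle x z). *)
Lemma angle_dist (k : R) x z : 0 <= k -> k <= 2 -> x != 0 -> z != 0 ->
  angle x z < acos (1 - k / 2) ->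
  dotv ((enorm x)^-1 *: x - (enorm z)^-1 *: z)
       ((enorm x)^-1 *: x - (enorm z)^-1 *: z) <= k.
Proof.
move=> k0 k2 x0 z0; rewrite /angle => h.
set x' := _ *: x; set z' := _ *: z.
have /unit_sphereE xx : unit_sphere x' by exact: normalize_unit.
have /unit_sphereE zz : unit_sphere z' by exact: normalize_unit.
set r := dotv x z / _ in h.
have rE : dotv x' z' = r by rewrite /x' /z' dotvZl dotvZr /r invfM; ring.
have r1 : -1 <= r <= 1.
  rewrite -ler_norml -rE; have := cauchy_schwarz x' z'.
  by rewrite /enorm xx zz sqrtr1 mulr1.
have k1 : -1 <= 1 - k / 2 <= 1 by apply/andP; split; lra.
have : 1 - k / 2 < r.
  rewrite -(acosK k1) -(acosK r1) ltr_cos // in_itv /=.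
    by rewrite acos_ge0 // acos_lepi.
  by rewrite acos_ge0 // acos_lepi.
by rewrite dotvBr !(dotvC (x' - z')) !dotvBr xx zz (dotvC z' x') rE; lra.
Qed.

Variables (a : 'I_m -> 'cV[R]_n) (s : seq 'cV[R]_n).
Variables (T t eta e : R).
Hypothesis n0 : (0 < n)%N.
Hypothesis T0 : 1 <= T.
Hypothesis t0 : 0 < t.
Hypothesis s_net : forall u, unit_sphere u -> exists2 v, v \in s & dotv (u - v) (u - v) <= e.
Hypothesis hB : forall v, v \in s -> \sum_k excess T (sproj (a k) v) ^+ 2 <= m%:R / 512.
Hypothesis hC : forall v, v \in s -> \sum_k \1_(band t) (sproj (a k) v) <= eta * m%:R.
Hypothesis hD : forall v, v \in s -> 7 / 8 * m%:R <= \sum_k sproj (a k) v ^+ 2.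

Let Lam := 16 * T ^+ 2 + 1 / 32.
Hypothesis he : 512 * (Lam * e) <= 1.

Let Q y := \sum_k sproj (a k) y ^+ 2.

Let T2 : 1 <= T ^+ 2. Proof. exact: exprn_ege1. Qed.

Let e4 : e <= 1 / 4.
Proof.
have : 16 <= Lam by rewrite /Lam; have := T2; lra.
move=> L16; rewrite leNgt; apply/negP => h.
have := mulr_ge0 (_ : 0 <= Lam - 16) (_ : 0 <= e - 1 / 4).
by rewrite !subr_ge0 L16 (ltW h) => /(_ isT isT); move: he; lra.
Qed.

Let QZ c y : Q (c *: y) = c ^+ 2 * Q y.
Proof. by rewrite /Q mulr_sumr; apply: eq_bigr => k _; rewrite sprojZ exprMn. Qed.

Let Q_bounded : has_sup [set Q u | u in @unit_sphere R n].
Proof.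
split; first by exists (Q (basisv R (Ordinal n0))); exists (basisv R (Ordinal n0)) => //; exact: unit_basisv.
exists (\sum_k n%:R * dotv (a k) (a k)) => _ [u /unit_sphereE u1 <-].
apply: ler_sum => k _; rewrite /sproj exprMn sqr_sqrtr ?ler0n // ler_wpM2l ?ler0n //.
by rewrite (le_trans (cauchy_schwarz_sq _ _)) // u1 mulr1.
Qed.

(** Let v be a point of the net near the unit vector u. Then
    Q u <= 2 Q v + 2 Q (u - v), where Q v is bounded by means of the excesses, and
    Q (u - v) is at most e times the supremum of Q over the sphere, hence can be
    absorbed. *)
Lemma operator_bound y : Q y <= Lam * m%:R * dotv y y.
Proof.
set M := sup [set Q u | u in @unit_sphere R n].
have QM u : unit_sphere u -> Q u <= M.
  by move=> u1; apply: (sup_upper_bound Q_bounded); exists u.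
have Qy z : Q z <= M * dotv z z.
  have [->|z0] := eqVneq z 0.
    by rewrite dotv0r mulr0 -(scale0r (0 : 'cV[R]_n)) QZ expr0n mul0r.
  have nz : 0 < enorm z by rewrite enorm_gt0.
  have := QM _ (normalize_unit z0); rewrite QZ exprVn enorm_sq mulrC.
  by rewrite ler_pdivrMr // -enorm_sq exprn_gt0.
have M0 : 0 <= M.
  apply: le_trans (QM _ (unit_basisv R (Ordinal n0))).
  by apply: sumr_ge0 => k _; exact: sqr_ge0.
suff ML : M <= Lam * m%:R by apply: le_trans (Qy y) _; rewrite ler_wpM2r // dotvv_ge0.
have Qs v : v \in s -> Q v <= (4 * T ^+ 2 + 1 / 128) * m%:R.
  move=> vs; apply: (@le_trans _ _ (\sum_(k < m) (4 * T ^+ 2 + 4 * excess T (sproj (a k) v) ^+ 2))).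
    by apply: ler_sum => k _; apply: excess_sq_le; exact: le_trans T0.
  rewrite big_split /= sumr_const card_ord -mulr_sumr -[_ *+ m]mulr_natr.
  by have := hB vs; lra.
suff : M <= 2 * ((4 * T ^+ 2 + 1 / 128) * m%:R) + M / 2 by rewrite /Lam; lra.
apply: ge_sup; first by case: Q_bounded.
move=> _ [u u1 <-]; have [v vs uv] := s_net u1.
have -> : Q u = Q (v + (u - v)) by rewrite addrC subrK.
apply: (@le_trans _ _ (2 * Q v + 2 * Q (u - v))).
  rewrite /Q !mulr_sumr -big_split /=; apply: ler_sum => k _.
  rewrite sprojD; set p := sproj _ _; set q := sproj _ _; have := sqr_ge0 (p - q).
  by rewrite !expr2; nra.
rewrite lerD ?ler_pM2l //; first exact: Qs.
have := le_trans (Qy (u - v)) (ler_wpM2l M0 (le_trans uv e4)); lra.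
Qed.

Let m0 : 0 <= m%:R :> R. Proof. exact: ler0n. Qed.
Let Lam0 : 0 <= Lam. Proof. by rewrite /Lam; have := T2; lra. Qed.

Let Q_near u v : dotv (u - v) (u - v) <= e -> Q (u - v) <= Lam * e * m%:R.
Proof.
move=> uv; apply: le_trans (operator_bound _) _.
by rewrite [leRHS]mulrAC ler_wpM2l // mulr_ge0.
Qed.

(* Uses (a + b)^2 <= (16/15) a^2 + 16 b^2, a ratio close to 1 so as to keep most of
   the 7/8. *)
Let Q_lower u : unit_sphere u -> 15 / 16 * (7 / 8 - 16 * (Lam * e)) * m%:R <= Q u.
Proof.
move=> u1; have [v vs uv] := s_net u1.
have : Q v <= 16 / 15 * Q u + 16 * Q (u - v).
  rewrite /Q !mulr_sumr -big_split /=; apply: ler_sum => k _.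
  rewrite sprojB; set p := sproj _ u; set q := sproj _ v.
  have := sqr_ge0 (p / 15 + (p - q)); rewrite !expr2; nra.
have := hD vs; rewrite -/(Q v); have := Q_near uv; lra.
Qed.

Let excess_upper u : unit_sphere u ->
  \sum_k excess T (sproj (a k) u) ^+ 2 <= (1 / 256 + 2 * (Lam * e)) * m%:R.
Proof.
move=> u1; have [v vs uv] := s_net u1.
apply: (@le_trans _ _ (\sum_k (2 * excess T (sproj (a k) v) ^+ 2 + 2 * sproj (a k) (u - v) ^+ 2))).
  apply: ler_sum => k _; have {1}-> : sproj (a k) u = sproj (a k) v + sproj (a k) (u - v).
    by rewrite -sprojD addrC subrK.
  exact: excess_sqD_le.
rewrite big_split /= -!mulr_sumr -/(Q (u - v)).
by have := hB vs; have := Q_near uv; lra.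
Qed.

(** If the signs of <v, x> and <v, z> differ then |<v, x>| <= |<v, x - z>|. So v is
    in the band around a point of the net near x unless one of the marginals at
    x - z and x - v is at least t / 2, and the second moments of these are small. *)
Let wedge_count kap x z : unit_sphere x -> unit_sphere z ->
  dotv (x - z) (x - z) <= kap ->
  \sum_k \1_(wedge x z) (a k) <= (eta + 4 * Lam * (kap + e) / t ^+ 2) * m%:R.
Proof.
move=> x1 z1 xz; have [v vs xv] := s_net x1.
have t2 : 0 < t ^+ 2 by rewrite exprn_gt0.
apply: (@le_trans _ _ (\sum_k (\1_(band t) (sproj (a k) v) +
    4 / t ^+ 2 * (sproj (a k) (x - z) ^+ 2 + sproj (a k) (x - v) ^+ 2)))).
  apply: ler_sum => k _; rewrite [leLHS]indicE.
  have c0 : 0 <= 4 / t ^+ 2 by rewrite divr_ge0 // ltW.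
  have S0 : 0 <= 4 / t ^+ 2 * (sproj (a k) (x - z) ^+ 2 + sproj (a k) (x - v) ^+ 2).
    by rewrite mulr_ge0 ?addr_ge0 ?sqr_ge0.
  case: (boolP (_ \in _)) => [|_]; last by rewrite addr_ge0 // indicE.
  rewrite inE => -[_ sgn]; rewrite indicE.
  case: (boolP (_ \in _)) => [_|]; first by rewrite lerDl.
  rewrite notin_setE /band /= => /negP; rewrite -ltNge => ltv.
  rewrite add0r mulrAC ler_pdivlMr // mul1r.
  have hx : `|sproj (a k) x| <= `|sproj (a k) (x - z)|.
    rewrite /sproj !normrM ler_wpM2l // dotvBr.
    set p := dotv _ x in sgn *; set q := dotv _ z in sgn *.
    have [p0|p0|p0] := ltgtP p 0; have [q0|q0|q0] := ltgtP q 0; move: sgn;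
      rewrite ?(ltr0_sg p0) ?(gtr0_sg p0) ?(ltr0_sg q0) ?(gtr0_sg q0) ?p0 ?q0 ?sgr0 // => _.
    - by rewrite !ltr0_norm //; lra.
    - by rewrite subr0.
    - by rewrite !gtr0_norm //; lra.
    - by rewrite subr0.
    - by rewrite normr0.
    - by rewrite normr0.
  have hv : `|sproj (a k) v| <= `|sproj (a k) x| + `|sproj (a k) (x - v)|.
    have -> : sproj (a k) v = sproj (a k) x - sproj (a k) (x - v) by rewrite sprojB; ring.
    exact: ler_normB.
  rewrite -[sproj (a k) (x - z) ^+ 2]real_normK ?num_real //.
  rewrite -[sproj (a k) (x - v) ^+ 2]real_normK ?num_real //.
  move: ltv hx hv; set A := `|_|; set B := `|_|; set C := `|_|; set D := `|_|.
  move=> h1 h2 h3; have CD : t <= C + D by lra.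
  have : t ^+ 2 <= (C + D) ^+ 2.
    by rewrite ler_sqr // nnegrE ?(le_trans _ CD) // ltW.
  have := sqr_ge0 (C - D); have := sqr_ge0 C; have := sqr_ge0 D; rewrite !expr2; lra.
rewrite big_split /= -mulr_sumr big_split /= -/(Q (x - z)) -/(Q (x - v)).
have Qxz : Q (x - z) <= Lam * kap * m%:R.
  by apply: le_trans (operator_bound _) _; rewrite [leRHS]mulrAC ler_wpM2l // mulr_ge0.
rewrite [leRHS]mulrDl; apply: lerD; first exact: hC.
rewrite [leRHS](_ : _ = 4 / t ^+ 2 * (Lam * (kap + e) * m%:R)); last by field; rewrite gt_eqF.
by rewrite ler_wpM2l ?divr_ge0 ?(ltW t2) //; have := Q_near xv; lra.
Qed.

(** By excess_sq_le the wedge costs at most 16 T^2 times its number of points plus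
    16 times the sum of squared excesses. Since Lam e <= 1/512, what remains of the
    total is at least 105/128 - 15/512 - (1/16 + 32/512) - 1/8 > 1/2, times m. *)
Lemma quadratic_form_lower kap x z u :
  16 * T ^+ 2 * (eta + 4 * Lam * (kap + e) / t ^+ 2) <= 1 / 8 ->
  unit_sphere x -> unit_sphere z -> dotv (x - z) (x - z) <= kap ->
  unit_sphere u ->
  m%:R / 2 <= \sum_k sproj (a k) u ^+ 2 * (1 - 4 * \1_(wedge x z) (a k)).
Proof.
move=> hk x1 z1 xz u1.
apply: (@le_trans _ _ (\sum_k (sproj (a k) u ^+ 2 -
    (16 * T ^+ 2 * \1_(wedge x z) (a k) + 16 * excess T (sproj (a k) u) ^+ 2)))); last first.
  apply: ler_sum => k _; rewrite indicE.
  have h1 := excess_sq_le (sproj (a k) u) (le_trans ler01 T0).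
  have h2 := sqr_ge0 (excess T (sproj (a k) u)).
  by case: (_ \in _); rewrite /= ?mulr1n ?mulr0n; move: h1 h2; lra.
rewrite sumrB big_split /= -!mulr_sumr -/(Q u).
have := Q_lower u1; have := excess_upper u1; have := wedge_count x1 z1 xz => h1 h2 h3.
have h4 := ler_wpM2l (mulr_ge0 (ler0n R 16) (sqr_ge0 T)) h1.
have h5 : 16 * T ^+ 2 * ((eta + 4 * Lam * (kap + e) / t ^+ 2) * m%:R) <= 1 / 8 * m%:R.
  by rewrite mulrA ler_wpM2r.
have h6 := ler_wpM2r m0 he.
by move: h2 h3 h4 h5 h6 m0; lra.
Qed.

End Deterministic.

(** * Failure probabilities *)

Section Final.
Variable R : realType.

(** The exponential is at most exp (-1) (1 + exp (1/eta) 1_band), so that the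
    probability p of the band must be small compared to exp (-1/eta). *)
Lemma mgf_band (n : nat) (nu : probability 'cV[R]_n R) (t p eta : R) u :
  uniform_on_sphere nu -> unit_sphere u -> 0 < eta ->
  p * expR eta^-1 <= 1 / 2 ->
  (\int[nu]_v (\1_(band t) (sproj v u))%:E <= p%:E)%E ->
  (\int[nu]_v (expR (eta^-1 * (\1_(band t) (sproj v u) - eta)))%:E <=
    (expR (- (1 / 2)))%:E)%E.
Proof.
move=> hnu u1 eta0 pe hp.
have mI : measurable_fun setT (fun v => \1_(band t) (sproj v u) : R).
  apply: measurableT_comp; last exact: measurable_sproj.
  by apply: measurable_indic; exact: measurable_band.
have e0 := expR_ge0 (eta^-1).
have c0 : 0 <= expR (- 1) * expR eta^-1 :> R by rewrite mulr_ge0 ?expR_ge0.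
apply: (@le_trans _ _ (\int[nu]_v (expR (- 1) + expR (- 1) * expR eta^-1 * \1_(band t) (sproj v u))%:E)%E).
  apply: sphere_le_integral => //.
  - apply: measurableT_comp => //; apply: measurable_funM => //.
    exact: measurable_funB.
  - by apply: measurable_funD => //; exact: measurable_funM.
  move=> v _; rewrite mulrBr mulVf ?gt_eqF // addrC expRD -mulrA.
  apply: (@le_trans _ _ (expR (- 1) * (1 + expR eta^-1 * \1_(band t) (sproj v u)))); last by rewrite mulrDr mulr1.
  rewrite ler_wpM2l ?expR_ge0 // indicE; case: (_ \in _); rewrite /= ?mulr1n ?mulr0n ?mulr1 ?mulr0.
    by rewrite lerDr.
  by rewrite expR0 addr0.
under eq_integral do rewrite EFinD EFinM.
rewrite ge0_integralD //; last by apply: measurable_funeM; exact/measurable_EFinP.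
rewrite ge0_integralZl_EFin //; last exact/measurable_EFinP.
rewrite (integral_const nu (expR (- 1))).
apply: (@le_trans _ _ ((expR (-1))%:E + (expR (-1) * expR eta^-1)%:E * p%:E)%E).
  by rewrite leeD2l // lee_wpmul2l.
rewrite -EFinM -EFinD lee_fin.
apply: (@le_trans _ _ (expR (- 1) * expR (1 / 2))); last by rewrite -expRD ler_expR; lra.
rewrite -mulrA -[X in X + _]mulr1 -mulrDr ler_wpM2l ?expR_ge0 //.
by apply: le_trans _ (expR_ge1Dx _); rewrite mulrC; lra.
Qed.

Section Sample.
Variables (n m : nat) (d : measure_display) (T : measurableType d).
Variables (P : probability T R) (a : 'I_m -> {mfun T >-> 'cV[R]_n}).
Hypothesis aind : mutually_independent P a.
Hypothesis aunif : forall i, uniform_on_sphere (distribution P (a i)).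

Definition bad_event (f : R -> R) u : set T :=
  [set w | 0 <= \sum_k f (sproj (a k w) u)].

Lemma measurable_bad f u : measurable_fun setT f -> measurable (bad_event f u).
Proof.
move=> mf; have mS : measurable_fun setT (fun w => \sum_k f (sproj (a k w) u)).
  apply: measurable_sum => k; apply: (measurableT_comp mf).
  by apply: (measurableT_comp (measurable_sproj u)).
rewrite /bad_event (_ : [set w | _] = setT `&` (fun w => \sum_k f (sproj (a k w) u)) @^-1` `[0, +oo[%classic).
  exact: mS.
by rewrite setTI; apply/seteqP; split => w /=; rewrite in_itv /= andbT.
Qed.

Lemma bad_event_le f u (c : R) : measurable_fun setT f ->
  (forall nu : probability 'cV[R]_n R, uniform_on_sphere nu ->
    \int[nu]_v (expR (f (sproj v u)))%:E <= (expR (- c))%:E)%E ->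
  (P (bad_event f u) <= (expR (- (m%:R * c)))%:E)%E.
Proof.
move=> mf hf.
have mfs : measurable_fun setT (fun v : 'cV[R]_n => f (sproj v u)).
  by apply: (measurableT_comp mf); exact: measurable_sproj.
rewrite -[m in m%:R](card_ord m).
apply: (chernoff aind (f := fun v => f (sproj v u))) => // i.
apply: le_trans (hf _ (aunif i)).
rewrite ge0_integral_distribution //.
by apply/measurable_EFinP; apply: measurableT_comp.
Qed.

Lemma union_bound (I : eqType) (s : seq I) (A : I -> set T) (c : R) :
  (forall v, v \in s -> measurable (A v)) ->
  (forall v, v \in s -> P (A v) <= c%:E)%E ->
  (P (\big[setU/set0]_(v <- s) A v) <= ((size s)%:R * c)%:E)%E.
Proof.
elim: s => [|v s IH] mA hA; first by rewrite big_nil measure0 mul0r.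
have mA' w : w \in s -> measurable (A w) by move=> ws; apply: mA; rewrite inE ws orbT.
have hA' w : w \in s -> (P (A w) <= c%:E)%E by move=> ws; apply: hA; rewrite inE ws orbT.
rewrite big_cons /= -natr1 addrC mulrDl mul1r EFinD.
apply: le_trans (measureU2 _ _ _) _.
- by apply: mA; rewrite mem_head.
- by rewrite big_seq; apply: bigsetU_measurable => w ws; exact: mA'.
by rewrite leeD // ?hA ?mem_head // IH.
Qed.

End Sample.
End Final.

(** * Choice of the constants and conclusion *)

Section Consts.
Variable R : realType.

Lemma small_excess_level (c : R) : 0 < c ->
  exists2 T : R, 1 <= T & sqexp_bound R * expR (- (T ^+ 2 / 32)) <= c.
Proof.
move=> c0.
have B0 : 0 <= sqexp_bound R by apply: le_trans (sqexp_bound_ge1 R).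
set B := sqexp_bound R in B0 *.
pose T : R := 1 + 32 * B / c.
have T1 : 1 <= T by rewrite lerDl !mulr_ge0 // invr_ge0 ltW.
exists T => //; rewrite expRN ler_pdivrMr ?expR_gt0 // mulrC -ler_pdivrMr //.
apply: le_trans _ (expR_ge1Dx _).
have : 32 * (B / c) <= T by rewrite /T mulrA lerDr.
have : T <= T ^+ 2 by rewrite expr2 ler_peMr //; lra.
by lra.
Qed.

Lemma sproj_sqE (n : nat) (v u : 'cV[R]_n) : n%:R * dotv v u ^+ 2 = sproj v u ^+ 2.
Proof. by rewrite /sproj exprMn sqr_sqrtr. Qed.

Lemma wedge_normalize (n : nat) (x z : 'cV[R]_n) : x != 0 -> z != 0 ->
  wedge ((enorm x)^-1 *: x) ((enorm z)^-1 *: z) = wedge x z.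
Proof.
have sgZ (y v : 'cV[R]_n) : y != 0 -> Num.sg (dotv v ((enorm y)^-1 *: y)) = Num.sg (dotv v y).
  by move=> y0; rewrite dotvZr sgrM gtr0_sg ?mul1r // invr_gt0 enorm_gt0.
by move=> x0 z0; apply/seteqP; split => v [v1 h]; split => //; move: h; rewrite !sgZ.
Qed.

Lemma acos_le_pihalf (x : R) : 0 <= x -> x <= 1 -> acos x <= pi / 2.
Proof.
move=> x0 x1; rewrite -acos0 leNgt; apply/negP => h.
have k0 : -1 <= (0 : R) <= 1 by rewrite lerN10 ler01.
have k1 : -1 <= x <= 1 by rewrite (le_trans (lerN10 _) x0).
have : cos (acos x) < cos (acos 0).
  by rewrite ltr_cos // in_itv /= acos_ge0 ?acos_lepi.
by rewrite !acosK // ltNge x0.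
Qed.

(** Half of c m pays for n (ln K + ln 3), by the first condition on m, and half for
    ln (1/delta), by the second one together with (pi / (2 theta))^2 >= 1 and
    ln (m / n) >= 0. *)
Lemma failure_small (c K delta theta : R) (n m : nat) : 0 < c -> 1 <= K ->
  0 < theta -> theta <= pi / 2 -> (0 < n)%N -> 0 < delta -> delta < 1 ->
  let C := 1 + 2 * (ln K + ln 3 + 1) / c in
  C * n%:R <= m%:R ->
  C * (pi / (2 * theta)) ^+ 2 * (n%:R * ln (m%:R / n%:R) + ln (1 / delta)) <= m%:R ->
  K ^+ n * (3 * expR (- (m%:R * c))) <= delta.
Proof.
move=> c0 K1 th0 th1 n0 d0 d1 C Cn Cm.
have nR : 1 <= n%:R :> R by rewrite ler1n.
have K0 : 0 < K by apply: lt_le_trans K1.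
have lnK0 : 0 <= ln K by rewrite ln_ge0.
have ln3 : 0 <= ln 3 :> R by rewrite ln_ge0 // ler1n.
have S0 : 0 <= 2 * (ln K + ln 3 + 1) / c.
  by rewrite divr_ge0 ?(ltW c0) // mulr_ge0 // !addr_ge0.
have C1 : 1 <= C by rewrite /C lerDl.
have Cc : 2 * (ln K + ln 3 + 1) <= C * c.
  by rewrite /C [leRHS]mulrDl mul1r divfK ?gt_eqF // lerDr ltW.
have nm : n%:R <= m%:R :> R.
  by apply: le_trans Cn; rewrite -[leLHS]mul1r ler_wpM2r.
have lmn : 0 <= ln (m%:R / n%:R) :> R.
  by rewrite ln_ge0 // ler_pdivlMr ?mul1r //; apply: lt_le_trans nR.
have ld : 0 <= ln (1 / delta) by rewrite ln_ge0 // ler_pdivlMr ?mul1r // ltW.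
have th : 1 <= (pi / (2 * theta)) ^+ 2.
  by rewrite exprn_ege1 // ler_pdivlMr ?mulr_gt0 // mul1r; lra.
have Cd : C * ln (1 / delta) <= m%:R.
  apply: le_trans Cm; rewrite -mulrA ler_wpM2l //; first lra.
  rewrite -[leLHS]mul1r; apply: ler_pM => //.
  by rewrite lerDr mulr_ge0.
have key : n%:R * ln K + ln 3 + ln (1 / delta) <= m%:R * c.
  have h1 : 2 * (ln K + ln 3 + 1) * n%:R <= m%:R * c.
    by apply: le_trans (ler_wpM2r (ltW c0) Cn); rewrite [leRHS]mulrAC ler_wpM2r.
  have h2 : 2 * ln (1 / delta) <= m%:R * c.
    apply: le_trans (ler_wpM2r (ltW c0) Cd); rewrite [leRHS]mulrAC ler_wpM2r //.
    by apply: le_trans Cc; lra.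
  have h3 : ln 3 <= ln 3 * n%:R :> R by rewrite -[leLHS]mulr1 ler_wpM2l.
  by move: h1; rewrite !mulrDr !mulrDl => h1; lra.
have -> : K ^+ n = expR (n%:R * ln K) by rewrite expRM_natl lnK // posrE.
rewrite -{1}[3](@lnK R _) ?posrE // -{1}[delta](@lnK R _) ?posrE //.
rewrite -!expRD ler_expR; move: key.
rewrite mul1r lnV ?posrE //; lra.
Qed.

End Consts.

Section Tests.
Variable R : realType.

(** The sum of each test over the sample is nonnegative if the sample is bad in the
    given direction: too large excesses, too many small marginals, or a too small
    sum of squares. *)
Definition excess_test (T r : R) : R := 1 / 32 * (excess T r ^+ 2 - 1 / 512).
Definition band_test (t eta r : R) : R := eta^-1 * (\1_(band t) r - eta).
Definition mass_test (l r : R) : R := l * (7 / 8 - r ^+ 2).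

Lemma measurable_excess_test T : measurable_fun setT (excess_test T).
Proof.
apply: measurable_funM => //; apply: measurable_funB => //.
by apply: measurable_funX; exact: measurable_excess.
Qed.

Lemma measurable_band_test t eta : measurable_fun setT (band_test t eta).
Proof.
apply: measurable_funM => //; apply: measurable_funB => //.
by apply: measurable_indic; exact: measurable_band.
Qed.

Lemma measurable_mass_test l : measurable_fun setT (mass_test l).
Proof. by apply: measurable_funM => //; apply: measurable_funB. Qed.

(** The hypothesis of chernoff, with the same rate in all dimensions; this is why the
    constant of the theorem can be absolute. *)
Definition fails_rarely (f : R -> R) (c : R) :=
  forall (n : nat) (nu : probability 'cV[R]_n R) (u : 'cV[R]_n), (0 < n)%N ->
  uniform_on_sphere nu -> unit_sphere u ->
  (\int[nu]_v (expR (f (sproj v u)))%:E <= (expR (- c))%:E)%E.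

Lemma fails_rarely_le f c c' : c' <= c -> fails_rarely f c -> fails_rarely f c'.
Proof.
move=> cc hf n nu u n0 hnu u1; apply: le_trans (hf n nu u n0 hnu u1) _.
by rewrite lee_fin ler_expR lerN2.
Qed.

Lemma excess_test_rare : exists2 T : R, 1 <= T &
  exists2 c, 0 < c & fails_rarely (excess_test T) c.
Proof.
pose e : R := 1 / 512.
have e0 : 0 < e by rewrite divr_gt0 ?ltr0n.
have [T T1 hT] := small_excess_level (divr_gt0 e0 (ltr0Sn R 63)).
exists T => //; exists (e / 64); first by rewrite divr_gt0 ?ltr0n.
move=> n nu u n0 hnu u1.
by apply: mgf_excess => //; apply: le_trans T1.
Qed.

Lemma band_test_rare (eta : R) : 0 < eta -> exists2 t : R, 0 < t &
  exists2 c, 0 < c & fails_rarely (band_test t eta) c.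
Proof.
move=> eta0; pose p : R := expR (- eta^-1) / 2.
have [|t t0 ht] := @small_ball R p; first by rewrite divr_gt0 ?expR_gt0.
exists t => //; exists (1 / 2); first by rewrite divr_gt0.
move=> n nu u n0 hnu u1.
apply: (@mgf_band _ _ _ _ p) => //; last exact: ht.
by rewrite /p mulrAC -expRD addNr expR0.
Qed.

Lemma mass_test_rare : exists2 l : R, 0 < l &
  exists2 c, 0 < c & fails_rarely (mass_test l) c.
Proof.
have M0 : 0 < fourth_bound R := lt_le_trans ltr01 (fourth_bound_ge1 R).
pose l : R := (16 * fourth_bound R)^-1.
have l0 : 0 < l by rewrite invr_gt0 mulr_gt0.
exists l => //; exists (l / 16); first by rewrite divr_gt0.
move=> n nu u n0 hnu u1; apply: mgf_lower => //.
by rewrite mulrAC mulfV // gt_eqF // mulr_gt0.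
Qed.

(** The scale 1 / N of the net is also used as the bound on the distance between the
    unit vectors that span the wedge, whence e + e. Each condition bounds N^2 from
    below, and N exceeds the sum X of the two bounds. *)
Lemma net_scale (T t : R) : 1 <= T -> 0 < t -> exists2 N : nat, (0 < N)%N &
  let Lam := 16 * T ^+ 2 + 1 / 32 in let e := (N%:R ^+ 2)^-1 in
  512 * (Lam * e) <= 1 /\
  16 * T ^+ 2 * ((24 * 16 * T ^+ 2)^-1 + 4 * Lam * (e + e) / t ^+ 2) <= 1 / 8.
Proof.
move=> T1 t0; have T0 : 0 < T by apply: lt_le_trans T1.
have T2 : 0 < T ^+ 2 by rewrite exprn_gt0.
have t2 : 0 < t ^+ 2 by rewrite exprn_gt0.
pose L : R := 16 * T ^+ 2 + 1 / 32.
have L0 : 0 < L by rewrite /L; clear -T2; lra.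
pose Y := 24 * 64 * T ^+ 2 * L / t ^+ 2.
have Y0 : 0 < Y by rewrite divr_gt0 // !mulr_gt0.
pose X : R := 512 * L + Y.
pose N := (Num.truncn X).+1.
have XN : X < N%:R by exact: truncnS_gt.
have NN : N%:R <= N%:R ^+ 2 :> R by rewrite expr2 ler_peMr // ler1n.
have N2 : 0 < N%:R ^+ 2 :> R by rewrite exprn_gt0 // ltr0n.
have XN2 : X <= N%:R ^+ 2 by apply: le_trans NN; exact: ltW.
exists N; first by [].
cbv zeta; rewrite -/L; set e := (N%:R ^+ 2)^-1; split.
  rewrite mulrA (ler_pdivrMr _ _ N2) [leRHS]mul1r; apply: le_trans XN2.
  by rewrite /X lerDl (ltW Y0).
have h2 : Y * e <= 1.
  rewrite (ler_pdivrMr _ _ N2) mul1r; apply: le_trans XN2.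
  by rewrite /X lerDr mulr_ge0 ?ler0n ?(ltW L0).
rewrite (_ : _ * _ = 1 / 24 + 1 / 12 * (Y * e)); last first.
  by rewrite /Y; field; rewrite !gt_eqF // -exprnP gt_eqF.
by clear -h2; lra.
Qed.

Section Point.
Variables (n m : nat) (d : measure_display) (W : measurableType d).
Variables (P : probability W R) (a : 'I_m -> {mfun W >-> 'cV[R]_n}).
Hypothesis n0 : (0 < n)%N.
Hypothesis aind : mutually_independent P a.
Hypothesis aunif : forall i, uniform_on_sphere (distribution P (a i)).

Definition point_failure (T t eta l : R) u : set W :=
  bad_event a (excess_test T) u `|`
  (bad_event a (band_test t eta) u `|` bad_event a (mass_test l) u).

Lemma measurable_point_failure T t eta l u : measurable (point_failure T t eta l u).
Proof.
by apply: measurableU; [|apply: measurableU]; apply: measurable_bad;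
  [exact: measurable_excess_test|exact: measurable_band_test|exact: measurable_mass_test].
Qed.

Lemma point_failure_le T t eta l u c : unit_sphere u ->
  fails_rarely (excess_test T) c -> fails_rarely (band_test t eta) c ->
  fails_rarely (mass_test l) c ->
  (P (point_failure T t eta l u) <= (3 * expR (- (m%:R * c)))%:E)%E.
Proof.
move=> u1 h1 h2 h3; set q := expR _.
have b1 : (P (bad_event a (excess_test T) u) <= q%:E)%E.
  apply: (bad_event_le aind aunif (measurable_excess_test T)) => nu hnu; exact: h1.
have b2 : (P (bad_event a (band_test t eta) u) <= q%:E)%E.
  apply: (bad_event_le aind aunif (measurable_band_test t eta)) => nu hnu; exact: h2.
have b3 : (P (bad_event a (mass_test l) u) <= q%:E)%E.
  apply: (bad_event_le aind aunif (measurable_mass_test l)) => nu hnu; exact: h3.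
have mb1 := measurable_bad a u (measurable_excess_test T).
have mb2 := measurable_bad a u (measurable_band_test t eta).
have mb3 := measurable_bad a u (measurable_mass_test l).
apply: le_trans (measureU2 _ mb1 (measurableU _ _ mb2 mb3)) _.
rewrite (_ : 3 * q = q + (q + q)); last by ring.
by rewrite !EFinD leeD // (le_trans (measureU2 _ mb2 mb3)) ?leeD.
Qed.

Lemma not_point_failure T t eta l u w : 0 < eta -> 0 < l ->
  ~ point_failure T t eta l u w ->
  [/\ \sum_k excess T (sproj (a k w) u) ^+ 2 <= m%:R / 512,
      \sum_k \1_(band t) (sproj (a k w) u) <= eta * m%:R &
      7 / 8 * m%:R <= \sum_k sproj (a k w) u ^+ 2].
Proof.
move=> eta0 l0 /not_orP[/negP h1 /not_orP[/negP h2 /negP h3]].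
have ei : 0 < eta^-1 by rewrite invr_gt0.
have i32 : (0 : R) < 1 / 32 by rewrite divr_gt0 ?ltr0n.
have sum_const (x : R) : \sum_(k < m) x = x * m%:R.
  by rewrite sumr_const card_ord mulr_natr.
split.
- move: h1; rewrite -ltNge -mulr_sumr sumrB sum_const (pmulr_rlt0 _ i32).
  by rewrite subr_lt0 mulrAC mul1r => /ltW.
- move: h2; rewrite -ltNge -mulr_sumr sumrB sum_const (pmulr_rlt0 _ ei).
  by rewrite subr_lt0 => /ltW.
- move: h3; rewrite -ltNge -mulr_sumr sumrB sum_const (pmulr_rlt0 _ l0).
  by rewrite subr_lt0 => /ltW.
Qed.

End Point.
End Tests.

Theorem theorem5p9 (R : realType) :
  exists theta0 C : R, [/\ 0 < theta0, 0 < C &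
    forall (theta : R) (n : nat) (delta : R) (m : nat)
      (d : measure_display) (T : measurableType d) (P : probability T R)
      (a : 'I_m -> {mfun T >-> 'cV[R]_n}),
      0 < theta -> theta <= theta0 -> (0 < n)%N -> 0 < delta ->
      C * n%:R <= m%:R ->
      C * (pi / (2 * theta)) ^+ 2 *
        (n%:R * ln (m%:R / n%:R) + ln (1 / delta)) <= m%:R ->
      mutually_independent P a ->
      (forall i, uniform_on_sphere (distribution P (a i))) ->
      exists E : set T,
        [/\ measurable E,
            E `<=` [set w | ACW theta (1 / 2)
                              (empirical_measure (fun i => a i w))] &
            ((1 - delta)%:E <= P E)%E]].
Proof.
have [T T1 [c1 c10 hB]] := excess_test_rare R.
have T0 : 0 < T by apply: lt_le_trans T1.
pose eta : R := (24 * 16 * T ^+ 2)^-1.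
have eta0 : 0 < eta by rewrite invr_gt0 !mulr_gt0.
have [t t0 [c2 c20 hC]] := band_test_rare eta0.
have [l l0 [c3 c30 hD]] := mass_test_rare R.
have [N N0 /=] := net_scale T1 t0; set e := (_ ^+ 2)^-1 => -[he hk].
have N2 : 1 <= N%:R ^+ 2 :> R by rewrite exprn_ege1 // ler1n.
have e0 : 0 < e by rewrite invr_gt0 (lt_le_trans ltr01).
have e1 : e <= 1 by rewrite invf_le1 // (lt_le_trans ltr01).
pose c := Num.min c1 (Num.min c2 c3).
have c0 : 0 < c by rewrite /c !lt_min c10 c20.
have {}hB : fails_rarely (excess_test T) c by apply: fails_rarely_le hB; rewrite /c !ge_min lexx.
have {}hC : fails_rarely (band_test t eta) c by apply: fails_rarely_le hC; rewrite /c !ge_min lexx orbT.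
have {}hD : fails_rarely (mass_test l) c by apply: fails_rarely_le hD; rewrite /c !ge_min lexx !orbT.
pose K : R := 4 * 2 ^+ N.
have K1 : 1 <= K.
  by rewrite /K -[leLHS]mulr1; apply: ler_pM; rewrite ?ler1n // exprn_ege1 // ler1n.
(* Unit vectors at an angle smaller than this are at distance at most 1 / N. *)
exists (acos (1 - e / 2)), (1 + 2 * (ln K + ln 3 + 1) / c); split.
- by rewrite acos_gt0 //; apply/andP; split; clear -e0 e1; lra.
- rewrite ltr_pwDl // divr_ge0 ?(ltW c0) // mulr_ge0 // !addr_ge0 // ln_ge0 //.
  by rewrite ler1n.
move=> theta n delta m d W P a th0 th1 n0 d0 Cn Cm aind aunif.
have [d1|d1] := leP 1 delta.
  exists set0; split => //.
  by rewrite measure0 lee_fin subr_le0.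
have thpi : theta <= pi / 2 by apply: le_trans th1 (acos_le_pihalf _ _); clear -e0 e1; lra.
have m0 : (0 < m)%N.
  rewrite -(ltr_nat R); apply: lt_le_trans Cn; rewrite mulr_gt0 ?ltr0n //.
  rewrite ltr_pwDl // divr_ge0 ?(ltW c0) // mulr_ge0 // !addr_ge0 // ln_ge0 //.
  by rewrite ler1n.
have [s [s_size s_unit s_net]] := @sphere_net R n N n0 N0.
pose bad := point_failure a T t eta l.
have mbad v : measurable (bad v) by exact: measurable_point_failure.
exists (~` \big[setU/set0]_(v <- s) bad v); split.
- by apply: measurableC; apply: bigsetU_measurable => v _.
- move=> w good /=.
  have good' v : v \in s -> ~ bad v w.
    by move=> vs bw; apply: good; rewrite -bigcup_seq; exists v.
  apply: ACW_empirical => // x z u x0 z0 xz u1.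
  have xz' := angle_dist (ltW e0) (le_trans e1 (ler1n _ 2)) x0 z0 (lt_le_trans xz th1).
  have := quadratic_form_lower n0 T1 t0 s_net _ _ _ he hk (normalize_unit x0) (normalize_unit z0) xz' u1.
  rewrite wedge_normalize //.
  under [X in _ -> _ <= X]eq_bigr do rewrite sproj_sqE.
  by apply=> v /good' /(not_point_failure eta0 l0)[].
- rewrite probability_setC; last by apply: bigsetU_measurable.
  rewrite EFinB leeB //.
  apply: le_trans (union_bound (fun v _ => mbad v) (fun v vs => point_failure_le n0 aind aunif (s_unit v vs) hB hC hD)) _.
  rewrite lee_fin; apply: le_trans (failure_small c0 K1 th0 thpi n0 d0 d1 Cn Cm).
  by rewrite ler_wpM2r // mulr_ge0 // expR_ge0.
Qed.
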